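(* Let $\alpha,\beta>-1$. A real-valued random variable $X$ is distributed according to the Beta distribution $\mu_{\alpha,\beta}$ on $[-1,1]$ if and only if for all functions $g\in\mathcal{K}_{\alpha,\beta}$ the expected values $E[(1-X^2)g'(X)]$ and $E[(\alpha+\beta+2)Xg(X)+(\alpha-\beta)g(X)]$ exist and coincide.
   Context: $\mu_{\alpha,\beta}$ is the probability distribution on $\mathbb{R}$ with density $p_{\alpha,\beta}(x)=C(\alpha,\beta)(1-x)^\alpha(1+x)^\beta1_{(-1,1)}(x)$, where $C(\alpha,\beta)=\frac{\Gamma(\alpha+\beta+2)}{2^{\alpha+\beta+1}\Gamma(\alpha+1)\Gamma(\beta+1)}$. Put $\rho_{\alpha,\beta}(x)=(1-x^2)p_{\alpha,\beta}(x)$. $\mathcal{K}_{\alpha,\beta}$ is the class of all continuous and piecewise continuously differentiable functions $g:\mathbb{R}\to\mathbb{R}$ vanishing at infinity ($g(x)\to0$ as $x\to\pm\infty$) with $\int_{\mathbb{R}}|g'(x)|\rho_{\alpha,\beta}(x)dx<\infty$. Piecewise continuously differentiable means: there are finitely many points dividing $\mathbb{R}$ into closed intervals on each of which $g$ is $C^1$ (one-sided derivatives at the endpoints). At the finitely many points where $g$ is not differentiable, $g'$ is given a fixed value by convention, e.g. the left derivative. *)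

(* Defs.v *)
From HB Require Import structures.
From mathcomp Require Import all_boot all_order all_algebra.
From mathcomp Require Import all_classical all_reals all_analysis.
Set Implicit Arguments.
Unset Strict Implicit.
Unset Printing Implicit Defensive.
Import Order.TTheory GRing.Theory Num.Theory.
Import numFieldNormedType.Exports.
Local Open Scope classical_set_scope.
Local Open Scope ring_scope.

(* Euler's integral; only used at s > 0, where it converges. *)
Definition Gamma {R : realType} (s : R) : R :=
  \int[lebesgue_measure]_(t in `]0, +oo[) (t `^ (s - 1) * expR (- t)).

Definition beta_const {R : realType} (a b : R) : R :=
  Gamma (a + b + 2) / (2 `^ (a + b + 1) * Gamma (a + 1) * Gamma (b + 1)).

(* The density p_{a,b}; the library's beta_pdf lives on [0, 1] and only has
   natural number parameters. *)
Definition beta_density {R : realType} (a b x : R) : R :=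
  beta_const a b * (1 - x) `^ a * (1 + x) `^ b * \1_(`]-1, 1[%classic) x.

Definition beta_rho {R : realType} (a b x : R) : R :=
  (1 - x ^+ 2) * beta_density a b x.

(* The distribution mu_{a,b}, as a set function. *)
Definition beta_distr {R : realType} (a b : R) (A : set R) : \bar R :=
  (\int[lebesgue_measure]_(x in A) (beta_density a b x)%:E)%E.

(* g is C^1 on I; the limits run over y in I, so that derivatives at the
   endpoints of an interval I are one-sided. *)
Definition C1_on {R : realType} (I : set R) (g : R -> R) : Prop :=
  exists dg : R -> R,
    {within I, continuous dg} /\
    forall x, I x ->
      (fun y => (g y - g x) / (y - x)) @ within I x^' --> dg x.

(* The breakpoints are x0 :: s. There is always at least one, which is no loss:
   a C^1 function on the line is C^1 on both sides of any point. *)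
Definition piecewise_C1 {R : realType} (g : R -> R) : Prop :=
  exists (x0 : R) (s : seq R),
    [/\ path <%R x0 s,
        C1_on `]-oo, x0] g,
        forall i, (i < size s)%N ->
          C1_on `[nth 0 (x0 :: s) i, nth 0 (x0 :: s) i.+1] g
      & C1_on `[last x0 s, +oo[ g].

(* D g is the derivative of g, completed by an arbitrary choice of values at
   the points where g is not differentiable (for instance the left derivative
   of g whenever it exists). *)
Definition derivative_convention {R : realType}
    (D : (R -> R) -> R -> R) : Prop :=
  forall (g : R -> R) (x : R), derivable g x 1 -> D g x = derive1 g x.

(* The class K_{a,b}, where g' stands for D g. *)
Definition classK {R : realType} (D : (R -> R) -> R -> R) (a b : R)
    (g : R -> R) : Prop :=
  [/\ continuous g,
      piecewise_C1 g,
      g x @[x --> +oo] --> 0 /\ g x @[x --> -oo] --> 0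
    & (\int[lebesgue_measure]_x (`|D g x| * beta_rho a b x)%:E < +oo)%E].

(* Main.v *)
Require Import Defs.
From HB Require Import structures.
From mathcomp Require Import all_boot all_order all_algebra.
From mathcomp Require Import all_classical all_reals all_analysis.
From mathcomp Require Import measurable_realfun.
From mathcomp Require Import ring lra.
Set Implicit Arguments.
Unset Strict Implicit.
Unset Printing Implicit Defensive.
Import Order.TTheory GRing.Theory Num.Theory.
Import numFieldNormedType.Exports.
Local Open Scope classical_set_scope.
Local Open Scope ring_scope.
(** Write p for the density, rho = (1 - x^2) p, kappa = alpha + beta + 2,
    delta = alpha - beta and tau(x) = kappa x + delta.

    The Beta law satisfies the identity.  Up to a constant, rho is
    (1 - x)^(alpha + 1) (1 + x)^(beta + 1), so rho' = - tau p on ]-1, 1[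
    ([is_derive_beta_rho]) and, the exponents being positive, rho is continuous
    on the line and vanishes at -1 and 1.  Integrating by parts against rho
    ([beta_integration_by_parts]),
      E[(1 - X^2) g'(X)] = int g' rho = - int g rho' = E[tau(X) g(X)],
    with no boundary term.  The breakpoints of g do no harm because
      S(x) = int_(-1)^x (g' rho - tau g p) - g(x) rho(x)
    is continuous and has derivative zero inside each piece.

    Conversely, let X satisfy the identity for all admissible g.
    - X lies in [-1, 1] almost surely ([stein_support]).  There is an odd g,
      zero on [-1, 1] and decaying like a small negative power at infinity, for
      which (1 - x^2) g' - tau g is negative off [-1, 1]; its mean is zero.
    - The moments of X are determined ([moment_unique]).  Taking g = x^n on
      [-1, 1] gives (n + kappa) m_(n+1) = n m_(n-1) - delta m_n, where
      n + kappa > 0.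
    - The Beta law satisfies the identity by the first part, so X has the moments
      of the Beta law; laws on [-1, 1] with equal moments are equal
      ([distribution_unique]), by Bernstein approximation of Lipschitz functions
      which in turn approximate indicators of rays.
    The test functions used here are smooth except at -1 and 1, where the factor
    1 - x^2 vanishes: neither atoms of X nor the convention for g' matter.

    The last step needs the Beta law to be a probability, that is, the value of
    the normalising constant ([integral_beta_density]).  It comes from
    Gamma(a + 1) Gamma(b + 1) = B(a + 1, b + 1) Gamma(a + b + 2), obtained by
    shearing a double integral ([gamma_intM]), together with
    0 < Gamma(s) < +oo for s > 0. *)

(** * Affine substitution for Lebesgue integrals *)

Section affine.
Context {R : realType}.
Notation mu := (@lebesgue_measure R).
Local Open Scope ereal_scope.

(** The pushforward of Lebesgue measure by x |-> c x + e, multiplied by c, gives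
    every interval its length. *)
Lemma ge0_integral_affine (f : R -> \bar R) (c e : R) : (0 < c)%R ->
  measurable_fun [set: R] f -> (forall x, 0 <= f x) ->
  \int[mu]_x f x = c%:E * \int[mu]_x f (c * x + e)%R.
Proof.
move=> c0 mf f0.
pose phi : measurableTypeR R -> measurableTypeR R := fun x => (c * x + e)%R.
have mphi : measurable_fun [set: measurableTypeR R] phi.
  by apply: measurable_funD => //; exact: measurable_funM.
pose c' := NngNum (ltW c0).
pose m : {measure set (measurableTypeR R) -> \bar R} :=
  mscale c' (pushforward mu phi).
have E (A : set (measurableTypeR R)) : measurable A -> mu A = m mphi A.
  apply: lebesgue_measure_unique => _ [[a b]] _ <- /=.
  rewrite /mscale/= /pushforward/=.
  rewrite (_ : phi @^-1` _ = `]((a - e) / c)%R, ((b - e) / c)%R]%classic).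
    rewrite !lebesgue_measure_itv/= !lte_fin.
    rewrite ltr_pM2r ?invr_gt0// ltrD2r; case: ifPn => // _; last by rewrite mule0.
    rewrite -EFinM; congr EFin.
    have := lt0r_neq0 c0.
    by move=> h; field.
  rewrite /phi; apply/seteqP; split => x /=; rewrite !in_itv/=;
  by rewrite ltr_pdivrMr// ler_pdivlMr// ltrBlDr lerBrDr mulrC.
rewrite (@eq_measure_integral _ _ R setT (m mphi)); last first.
  by move=> A mA _; exact: E.
rewrite ge0_integral_mscale//; congr (_ * _).
by rewrite (ge0_integral_pushforward mphi).
Qed.

End affine.

(** * Euler integrals and the mass of the Beta density *)

Section beta_integral.
Context {R : realType}.
Notation mu := (@lebesgue_measure R).

Lemma gt0_powRD (x r s : R) : 0 < x -> x `^ (r + s) = x `^ r * x `^ s.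
Proof. by move=> x0; rewrite powRD// (gt_eqF x0) implybT. Qed.

(** Cutting powers at 0 turns the integrals of Euler over half-lines and segments
    into integrals over the whole line, where affine substitutions apply without
    tracking a domain. *)
Definition tpow (s x : R) : R := x `^ s * \1_(`]0, +oo[%classic) x.

Lemma tpowE s x : 0 < x -> tpow s x = x `^ s.
Proof. by move=> x0; rewrite /tpow indicE mem_set ?mulr1//= in_itv/= x0. Qed.

Lemma tpow0 s x : x <= 0 -> tpow s x = 0.
Proof.
move=> x0; rewrite /tpow indicE memNset ?mulr0//= in_itv/= andbT => x1.
by move: x0; rewrite leNgt x1.
Qed.

Lemma tpow_ge0 s x : 0 <= tpow s x.
Proof. by rewrite /tpow mulr_ge0// powR_ge0. Qed.

Lemma measurable_tpow s : measurable_fun [set: R] (tpow s).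
Proof. by apply: measurable_funM => //; exact: measurable_powR. Qed.

Lemma tpowM s c x : 0 < c -> tpow s (c * x) = c `^ s * tpow s x.
Proof.
move=> c0; have [x0|x0] := ltP 0 x; last by rewrite !tpow0 ?mulr0// pmulr_rle0.
by rewrite !tpowE ?mulr_gt0// powRM// ltW.
Qed.

Local Open Scope ereal_scope.

Definition gamma_int (s : R) : \bar R :=
  \int[mu]_x (tpow (s - 1) x * expR (- x))%:E.

Definition beta_int (a b : R) : \bar R :=
  \int[mu]_x (tpow a x * tpow b (1 - x))%:E.

Lemma measurable_tpow_exp s :
  measurable_fun [set: R] (fun x => (tpow s x * expR (- x))%R).
Proof.
apply: measurable_funM; first exact: measurable_tpow.
by apply: measurableT_comp => //; exact: measurableT_comp.
Qed.

Lemma measurable_tpow_tpow a b u :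
  measurable_fun [set: R] (fun x => (tpow a x * tpow b (u - x))%R).
Proof.
apply: measurable_funM; first exact: measurable_tpow.
apply: measurableT_comp; first exact: measurable_tpow.
by apply: measurable_funB.
Qed.

(** Substituting u x for x makes the convolution of two truncated powers
    homogeneous in u > 0; for u <= 0 the two supports do not meet. *)
Lemma beta_int_scale a b u :
  \int[mu]_x (tpow a x * tpow b (u - x))%:E =
  beta_int a b * (tpow (a + b + 1) u)%:E.
Proof.
have [u0|u0] := ltP 0%R u; last first.
  rewrite [in RHS]tpow0// mule0 integral0_eq// => x _.
  have [x0|x0] := ltP 0%R x; last by rewrite tpow0// mul0r.
  by rewrite (@tpow0 b) ?mulr0// lerBlDr add0r (le_trans u0)// ltW.
rewrite (@ge0_integral_affine R _ u 0)//; last 2 first.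
- by apply/measurable_EFinP; exact: measurable_tpow_tpow.
- by move=> x; rewrite lee_fin mulr_ge0 ?tpow_ge0.
under eq_integral => x _.
  rewrite addr0 (_ : u - u * x = u * (1 - x))%R; last by rewrite mulrBr mulr1.
  rewrite !tpowM// mulrACA EFinM; over.
rewrite ge0_integralZl//=; last 3 first.
- by apply/measurable_EFinP; exact: measurable_tpow_tpow.
- by move=> x _; rewrite lee_fin mulr_ge0 ?tpow_ge0.
- by rewrite lee_fin mulr_ge0 ?powR_ge0.
rewrite muleA -EFinM muleC tpowE//; congr (_ * _%:E).
rewrite -{1}(powRr1 (ltW u0)) -!gt0_powRD//.
by rewrite addrC.
Qed.

(** Euler's argument: in the double integral of x^a y^b exp (- x - y), shear by
    u = x + y and integrate over x first; the inner integral is the convolution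
    of two truncated powers. *)
Lemma gamma_intM a b :
  gamma_int (a + 1) * gamma_int (b + 1) = beta_int a b * gamma_int (a + b + 2).
Proof.
have g0 s x : (0 <= tpow s x * expR (- x))%R by rewrite mulr_ge0 ?tpow_ge0 ?expR_ge0.
have mg s := measurable_tpow_exp s.
rewrite /gamma_int !addrK (_ : a + b + 2 - 1 = a + b + 1)%R; last by ring.
transitivity (\int[mu]_x \int[mu]_u
    (tpow a x * tpow b (u - x) * expR (- u))%:E).
  rewrite -ge0_integralZr//; last 3 first.
  - by apply/measurable_EFinP; exact: mg.
  - by move=> x _; rewrite lee_fin.
  - by apply: integral_ge0 => x _; rewrite lee_fin.
  apply: eq_integral => x _.
  rewrite -ge0_integralZl//; last 3 first.
  - by apply/measurable_EFinP; exact: mg.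
  - by move=> y _; rewrite lee_fin.
  - by rewrite lee_fin.
  rewrite [LHS](@ge0_integral_affine R _ 1%R (- x)%R) ?mul1e//; last 2 first.
  - apply: emeasurable_funM; first by apply/measurable_EFinP; exact: measurable_cst.
    by apply/measurable_EFinP; exact: mg.
  - by move=> y; rewrite mule_ge0// lee_fin.
  apply: eq_integral => u _; rewrite mul1r -EFinM; congr EFin.
  rewrite mulrACA; congr (_ * _)%R.
  by rewrite -expRD; congr expR; ring.
rewrite (@fubini_tonelli _ _ _ _ R mu mu
   (fun z => (tpow a z.1 * tpow b (z.2 - z.1) * expR (- z.2))%:E))/=; last 2 first.
- apply/measurable_EFinP; apply: measurable_funM; first apply: measurable_funM.
  + exact: (measurableT_comp (measurable_tpow a) measurable_fst).
  + apply: (measurableT_comp (measurable_tpow b)).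
    apply: measurable_funB; [exact: measurable_snd|exact: measurable_fst].
  + apply: (measurableT_comp (@measurable_expR R)).
    apply: measurable_funN; exact: measurable_snd.
- move=> z; rewrite lee_fin; apply: mulr_ge0; last exact: expR_ge0.
  by apply: mulr_ge0; exact: tpow_ge0.
rewrite -ge0_integralZl//; last 3 first.
- by apply/measurable_EFinP; exact: mg.
- by move=> x _; rewrite lee_fin.
- by apply: integral_ge0 => x _; rewrite lee_fin mulr_ge0 ?tpow_ge0.
apply: eq_integral => u _.
under eq_integral do rewrite EFinM.
rewrite ge0_integralZr//.
- by rewrite beta_int_scale -muleA -EFinM.
- by apply/measurable_EFinP; exact: measurable_tpow_tpow.
- by move=> x _; rewrite lee_fin mulr_ge0 ?tpow_ge0.
Qed.

End beta_integral.

Section gamma_finite.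
Context {R : realType}.
Notation mu := (@lebesgue_measure R).

Lemma gamma_int_itv (s : R) :
  gamma_int s = (\int[mu]_(x in `]0%R, +oo[) (x `^ (s - 1) * expR (- x))%:E)%E.
Proof.
rewrite integral_mkcond epatch_indic; apply: eq_integral => x _.
by rewrite /= -EFinM mulrAC.
Qed.

Lemma GammaE (s : R) : Gamma s = fine (gamma_int s).
Proof. by rewrite gamma_int_itv. Qed.

(** For y = x / (2 s) this says y^s <= (exp y)^s, up to the factor (2 s)^s. *)
Lemma powR_le_expR (s x : R) : 0 < s -> 0 <= x ->
  x `^ s <= (2 * s) `^ s * expR (x / 2).
Proof.
move=> s0 x0; have s20 : 0 < 2 * s by rewrite mulr_gt0.
have y0 : 0 <= x / (2 * s) by rewrite divr_ge0// ltW.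
have -> : x `^ s = (2 * s) `^ s * (x / (2 * s)) `^ s.
  by rewrite -powRM ?(ltW s20)// mulrC divfK ?gt_eqF.
rewrite ler_wpM2l ?powR_ge0//.
rewrite (_ : x / 2 = x / (2 * s) * s); last by field; rewrite gt_eqF.
rewrite expRM; apply: ge0_ler_powR; rewrite ?nnegrE ?expR_ge0 ?(ltW s0)//.
by apply: le_trans (expR_ge1Dx _); rewrite lerDr.
Qed.

(** A majorant of the integrand of Gamma, up to a constant, on the whole
    half-line, with a bounded explicit antiderivative: near 0 it has the right
    singularity s x^(s - 1), and at infinity it decays only polynomially. *)
Lemma is_derive_powR_ratio (s x : R) : 0 < x ->
  is_derive x 1 (fun y => - (1 + y `^ s)^-1)
    (s * x `^ (s - 1) / (1 + x `^ s) ^+ 2).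
Proof.
move=> x0.
have n0 : 1 + x `^ s != 0 by rewrite gt_eqF// ltr_pwDl// powR_ge0.
have := is_derive1_powR s x0 => h.
apply: is_derive_eq.
by rewrite add0r mul1r scaleNr opprK /GRing.scale/= mulrC.
Qed.

(** The integrand is at most K f, where f is the derivative of - 1 / (1 + x^s).
    The antiderivative varies by at most 1, which bounds the integral over every
    segment [1 / (n + 1), n + 1] by K. *)
Lemma gamma_int_lty (s : R) : 0 < s -> (gamma_int s < +oo)%E.
Proof.
move=> s0.
pose C := (2 * s) `^ s.
pose K := (1 + C) ^+ 2 / s.
have C0 : 0 <= C by exact: powR_ge0.
have K0 : 0 <= K by rewrite divr_ge0 ?(ltW s0)// sqr_ge0.
pose f x : R := s * x `^ (s - 1) / (1 + x `^ s) ^+ 2.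
have le_f x : 0 < x -> x `^ (s - 1) * expR (- x) <= K * f x.
  move=> x0; rewrite /K /f.
  have -> : (1 + C) ^+ 2 / s * (s * x `^ (s - 1) / (1 + x `^ s) ^+ 2) =
     x `^ (s - 1) * ((1 + C) / (1 + x `^ s)) ^+ 2.
    field.
    by rewrite (gt_eqF s0) andbT gt_eqF// ltr_pwDl// powR_ge0.
  rewrite ler_wpM2l ?powR_ge0//.
  rewrite (_ : - x = 2%:R * (- (x / 2))); last by field.
  rewrite expRM_natl lerXn2r ?nnegrE ?expR_ge0// ?divr_ge0 ?addr_ge0 ?powR_ge0//.
  rewrite expRN ler_pdivlMr ?ltr_pwDl ?powR_ge0// mulrC ler_pdivrMr ?expR_gt0//.
  rewrite mulrDl mul1r lerD//; last by apply: powR_le_expR => //; exact: ltW.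
  by rewrite -expR0 ler_expR divr_ge0 ?ltW.
pose F n : set R := `[n.+1%:R^-1, n.+1%:R]%classic.
have Fpos n x : F n x -> 0 < x.
  by rewrite /F/= in_itv/= => /andP[+ _]; apply: lt_le_trans; rewrite invr_gt0.
have FE : \bigcup_n F n = `]0, +oo[%classic.
  apply/seteqP; split => x/=; first by case=> n _ /Fpos; rewrite in_itv/= andbT.
  rewrite in_itv/= andbT => x0; exists (maxn (Num.trunc x) (Num.trunc x^-1)) => //.
  rewrite /F/= in_itv/=; apply/andP; split.
    rewrite invf_ple ?posrE ?ltr0n ?invr_gt0//.
    apply/ltW/(lt_le_trans (truncnS_gt _)).
    by rewrite ler_nat ltnS leq_maxr.
  apply/ltW/(lt_le_trans (truncnS_gt _)).
  by rewrite ler_nat ltnS leq_maxl.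
have mg : measurable_fun [set: R] (fun x => x `^ (s - 1) * expR (- x)).
  apply: measurable_funM; first exact: measurable_powR.
  by apply: measurableT_comp => //; exact: measurableT_comp.
have g0 x : (0 <= (x `^ (s - 1) * expR (- x))%:E)%E.
  by rewrite lee_fin mulr_ge0 ?powR_ge0 ?expR_ge0.
have bnd n : (\int[mu]_(x in F n) (x `^ (s - 1) * expR (- x))%:E <= K%:E)%E.
  have F1 : (1 <= n.+1%:R :> R) by rewrite ler1n.
  have [n1|n1] := leP (n.+1%:R : R) 1.
    have -> : F n = [set 1].
      have n11 : (n.+1%:R : R) = 1 by apply/eqP; rewrite eq_le n1 F1.
      by rewrite /F n11 invr1 set_itv1.
    by rewrite integral_set1 lee_fin.
  have ab : (n.+1%:R^-1 : R) < n.+1%:R.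
    by rewrite (lt_trans _ n1)// invf_lt1// (lt_trans _ n1).
  have cf : {within F n, continuous f}.
    apply: derivable_within_continuous => x /Fpos x0.
    apply: derivableM.
      apply: derivableM => //; apply: derivable_powR.
      by rewrite in_itv/= x0.
    have dV : derivable (fun y => (1 + y `^ s)^-1) x 1.
      rewrite (_ : (fun y => _) = - (fun y => - (1 + y `^ s)^-1)); last first.
        by apply/funext => y; rewrite fctE opprK.
      by apply: derivableN; have [] := is_derive_powR_ratio s x0.
    rewrite (_ : (fun y => _) =
        (fun y => (1 + y `^ s)^-1) * (fun y => (1 + y `^ s)^-1)).
      exact: derivableM.
    by apply/funext => y; rewrite fctE -invfM expr2.
  have dF x : F n x -> derivable (fun y => - (1 + y `^ s)^-1) x 1.
    by move=> /Fpos x0; have [] := is_derive_powR_ratio s x0.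
  have cF x : F n x -> {for x, continuous (fun y => - (1 + y `^ s)^-1)}.
    by move=> Fx; apply: differentiable_continuous; exact/derivable1_diffP/dF.
  have := @continuous_FTC2 R f (fun y => - (1 + y `^ s)^-1) _ _ ab cf.
  move=> FTC.
  apply: (@le_trans _ _ (\int[mu]_(x in F n) (K * f x)%:E)%E).
    apply: ge0_le_integral => //.
    - exact: measurable_itv.
    - apply/measurable_EFinP; exact: measurable_funTS.
    - apply/measurable_EFinP; apply: measurable_funM => //.
      by apply: subspace_continuous_measurable_fun; first exact: measurable_itv.
    - by move=> x /Fpos x0; rewrite lee_fin; exact: le_f.
  under eq_integral do rewrite EFinM.
  rewrite ge0_integralZl//; last 3 first.
  - exact: measurable_itv.
  - apply/measurable_EFinP.
    by apply: subspace_continuous_measurable_fun; first exact: measurable_itv.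
  - move=> x /Fpos x0; rewrite lee_fin /f divr_ge0 ?sqr_ge0// mulr_ge0 ?powR_ge0//.
    exact: ltW.
  rewrite FTC.
  - rewrite -EFinB -EFinM lee_fin opprK ler_piMr//.
    rewrite addrC -[leRHS]subr0 lerB ?invr_ge0 ?addr_ge0 ?powR_ge0//.
    by rewrite invf_le1 ?lerDl ?ltr_pwDl ?powR_ge0.
  - split.
    + by move=> x /subset_itv_oo_cc; exact: dF.
    + by apply: cvg_at_right_filter; apply: cF; rewrite /F/= in_itv/= lexx ltW.
    + by apply: cvg_at_left_filter; apply: cF; rewrite /F/= in_itv/= lexx ltW.
  - move=> x /subset_itv_oo_cc /Fpos x0; rewrite derive1E.
    by have [_ ->] := is_derive_powR_ratio s x0.
have nF : nondecreasing_seq F.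
  move=> m n mn; apply/subsetPset => x; rewrite /F/= !in_itv/= => /andP[h1 h2].
  have mn1 : (m.+1%:R <= n.+1%:R :> R) by rewrite ler_nat.
  rewrite (le_trans h2)// andbT (le_trans _ h1)//.
  by rewrite lef_pV2 ?posrE ?ltr0n.
have mF n : measurable (F n) by exact: measurable_itv.
have mgF n : measurable_fun (F n) (fun x => (x `^ (s - 1) * expR (- x))%:E).
  by apply/measurable_EFinP; exact: measurable_funTS.
(* monotone convergence along the segments F n, which exhaust ]0, +oo[ *)
rewrite gamma_int_itv -FE.
apply: le_lt_trans (ltry K).
have /cvg_lim <- // := @ge0_nondecreasing_set_cvg_integral _ _ _ _ _ mu nF mF mgF
  (fun _ x _ => g0 x).
apply: lime_le; last exact: nearW.
apply: ereal_nondecreasing_is_cvgn.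
exact: ge0_nondecreasing_set_nondecreasing_integral.
Qed.

(** Otherwise the nonnegative integrand would vanish almost everywhere, while it
    is positive on the interval ]0, 1] of length 1. *)
Lemma gamma_int_gt0 (s : R) : (0 < gamma_int s)%E.
Proof.
rewrite lt_neqAle eq_sym; apply/andP; split; last first.
  by apply: integral_ge0 => x _; rewrite lee_fin mulr_ge0 ?tpow_ge0 ?expR_ge0.
apply/eqP; rewrite gamma_int_itv => g0.
have mg : measurable_fun [set: R] (fun x => x `^ (s - 1) * expR (- x)).
  apply: measurable_funM; first exact: measurable_powR.
  by apply: measurableT_comp => //; exact: measurableT_comp.
have : (\int[mu]_(x in `]0%R, +oo[) `|(x `^ (s - 1) * expR (- x))%:E| = 0)%E.
  rewrite -[RHS]g0; apply: eq_integral => x _.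
  by rewrite gee0_abs// lee_fin mulr_ge0 ?powR_ge0 ?expR_ge0.
move/ae_eq_integral_abs => []//.
  by apply/measurable_EFinP; exact: measurable_funTS.
move=> N [mN N0] /= sN.
have : (mu `]0%R, 1%R] <= mu N)%E.
  apply: le_measure; rewrite ?inE//.
  move=> x /=; rewrite in_itv/= => /andP[x0 _]; apply: sN => /=.
  rewrite in_itv/= x0 => /(_ isT)[] /eqP.
  by rewrite mulf_eq0 gt_eqF ?powR_gt0//= gt_eqF// expR_gt0.
by rewrite N0 lebesgue_measure_itv/= lte_fin ltr01 sube0 lee_fin ler10.
Qed.

End gamma_finite.

Section beta_density_prob.
Context {R : realType}.
Notation mu := (@lebesgue_measure R).

Lemma gamma_intE (s : R) : 0 < s -> gamma_int s = (Gamma s)%:E.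
Proof.
move=> s0; rewrite GammaE fineK// ge0_fin_numE ?gamma_int_lty//.
exact/ltW/gamma_int_gt0.
Qed.

Lemma Gamma_gt0 (s : R) : 0 < s -> 0 < Gamma s.
Proof. by move=> s0; rewrite -lte_fin -gamma_intE// gamma_int_gt0. Qed.

(** Dividing the relation between the Euler integrals by Gamma(a + b + 2) is
    licit because that value is finite and nonzero. *)
Lemma beta_intE (a b : R) : -1 < a -> -1 < b ->
  beta_int a b = (Gamma (a + 1) * Gamma (b + 1) / Gamma (a + b + 2))%:E.
Proof.
move=> a1 b1.
have a0 : 0 < a + 1 by rewrite -(addNr 1) ltrD2r.
have b0 : 0 < b + 1 by rewrite -(addNr 1) ltrD2r.
have ab0 : 0 < a + b + 2 by lra.
have := gamma_intM a b; rewrite !gamma_intE//.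
have G0 := Gamma_gt0 ab0.
have : (0 <= beta_int a b)%E.
  by apply: integral_ge0 => x _; rewrite lee_fin mulr_ge0 ?tpow_ge0.
case: (beta_int a b) => [r| |] // _.
  by rewrite -!EFinM => -[->]; rewrite mulfK ?gt_eqF.
by rewrite gt0_mulye ?lte_fin// -EFinM.
Qed.

Lemma beta_densityE (a b x : R) : beta_density a b x =
  beta_const a b * (tpow a (1 - x) * tpow b (1 + x)).
Proof.
rewrite /beta_density indicE mem_setE -(mulrA (beta_const a b)) -mulrA.
congr (_ * _); have [|] := boolP (x \in `]-1, 1[); rewrite in_itv/= ?mulr1.
  move=> /andP[x1 x2]; rewrite (@tpowE _ a) ?(@tpowE _ b)//; lra.
rewrite negb_and -!leNgt mulr0 => /orP[xN1|x1].
  by rewrite (@tpow0 _ b) ?mulr0//; lra.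
by rewrite (@tpow0 _ a) ?mul0r//; lra.
Qed.

Lemma beta_const_ge0 (a b : R) : -1 < a -> -1 < b -> 0 <= beta_const a b.
Proof.
move=> a1 b1; rewrite divr_ge0// ?mulr_ge0 ?powR_ge0// ltW// Gamma_gt0//; lra.
Qed.

Lemma beta_density_ge0 (a b x : R) : -1 < a -> -1 < b ->
  0 <= beta_density a b x.
Proof.
move=> a1 b1; rewrite beta_densityE; apply: mulr_ge0.
  exact: beta_const_ge0.
by apply: mulr_ge0; exact: tpow_ge0.
Qed.

Lemma measurable_beta_density (a b : R) :
  measurable_fun [set: R] (beta_density a b).
Proof.
rewrite (_ : beta_density a b = fun x => beta_const a b *
  (tpow a (1 - x) * tpow b (1 + x))); last first.
  by apply/funext => x; exact: beta_densityE.
apply: measurable_funM => //; apply: measurable_funM.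
  by apply: (measurableT_comp (measurable_tpow a)); exact: measurable_funB.
by apply: (measurableT_comp (measurable_tpow b)); exact: measurable_funD.
Qed.

(** The substitution x = 2 t - 1 leads to the beta integral on ]0, 1[; the
    normalising constant cancels its value and the powers of 2. *)
Lemma integral_beta_density (a b : R) : -1 < a -> -1 < b ->
  (\int[mu]_x (beta_density a b x)%:E = 1)%E.
Proof.
move=> a1 b1.
have a0 : 0 < a + 1 by rewrite -(addNr 1) ltrD2r.
have b0 : 0 < b + 1 by rewrite -(addNr 1) ltrD2r.
have ab0 : 0 < a + b + 2 by lra.
rewrite (@ge0_integral_affine R _ 2 (-1))//; last 2 first.
- by apply/measurable_EFinP; exact: measurable_beta_density.
- by move=> x; rewrite lee_fin beta_density_ge0.
have E (x : R) : beta_density a b (2 * x + (-1)) =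
    (beta_const a b * (2 `^ a * 2 `^ b)) * (tpow b x * tpow a (1 - x)).
  rewrite beta_densityE (_ : 1 - (2 * x + (-1)) = 2 * (1 - x)); last by ring.
  rewrite (_ : 1 + (2 * x + (-1)) = 2 * x); last by ring.
  by rewrite (@tpowM _ a)// (@tpowM _ b)//; ring.
under eq_integral do rewrite E EFinM.
rewrite ge0_integralZl//; last 3 first.
- by apply/measurable_EFinP; exact: measurable_tpow_tpow.
- by move=> x _; rewrite lee_fin mulr_ge0 ?tpow_ge0.
- rewrite lee_fin; apply: mulr_ge0; first exact: beta_const_ge0.
  by rewrite mulr_ge0 ?powR_ge0.
rewrite -[X in (_ * (_ * X))%E]/(beta_int b a) beta_intE// -!EFinM; congr EFin.
rewrite /beta_const (addrC b a) gt0_powRD// gt0_powRD// powRr1//.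
field.
have h (x : R) : 2 `^ x != 0 by rewrite gt_eqF// powR_gt0.
by rewrite !h !gt_eqF ?Gamma_gt0.
Qed.

End beta_density_prob.

(** * Laws with a density *)

Section density.
Context d (T : measurableType d) (R : realType).
Variables (mu : {sigma_finite_measure set T -> \bar R})
          (nu : {finite_measure set T -> \bar R}) (p : T -> R).
Hypotheses (mp : measurable_fun [set: T] p) (p0 : forall x, 0 <= p x).
Hypothesis nuE : forall A, measurable A -> nu A = (\int[mu]_(x in A) (p x)%:E)%E.
Local Open Scope ereal_scope.

Let mpE : measurable_fun [set: T] (EFin \o p).
Proof. exact/measurable_EFinP. Qed.

Let int_p : mu.-integrable [set: T] (EFin \o p).
Proof.
apply/integrableP; split => //.
under eq_integral do rewrite /= ger0_norm//.
by rewrite -nuE// ltey_eq fin_num_measure.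
Qed.

(** A density agrees almost everywhere with the Radon-Nikodym derivative, for
    which the formula is known. *)
Lemma ge0_integral_density (f : T -> \bar R) : measurable_fun [set: T] f ->
  (forall x, 0 <= f x) -> \int[nu]_x f x = \int[mu]_x (f x * (p x)%:E).
Proof.
move=> mf f0.
have numu : nu `<< mu.
  apply/null_content_dominatesP => A mA muA0; rewrite nuE//.
  by apply: null_set_integral => //; exact: measurable_funTS.
rewrite -(Radon_Nikodym_SigmaFinite.change_of_variables numu)//.
have intf := Radon_Nikodym_SigmaFinite.f_integrable numu.
apply: ae_eq_integral => //.
- by apply: emeasurable_funM => //; exact: measurable_int intf.
- exact: emeasurable_funM.
- apply: ae_eqe_mul2l; apply: integral_ae_eq => // E _ mE.
  by rewrite -Radon_Nikodym_SigmaFinite.f_integral// nuE.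
Qed.

Lemma integrable_density (h : T -> R) : measurable_fun [set: T] h ->
  nu.-integrable [set: T] (EFin \o h) <->
  mu.-integrable [set: T] (fun x => (h x * p x)%:E).
Proof.
move=> mh.
have E : \int[nu]_x `|(h x)%:E| = \int[mu]_x `|(h x * p x)%:E|.
  rewrite ge0_integral_density//; last by do 2 apply: measurableT_comp => //.
  by apply: eq_integral => x _; rewrite -EFinM /= normrM (ger0_norm (p0 x)).
split=> /integrableP[_ i]; apply/integrableP; split.
- by apply/measurable_EFinP; exact: measurable_funM.
- by rewrite -E.
- exact/measurable_EFinP.
- by rewrite /comp E.
Qed.

Lemma integral_density (h : T -> R) : measurable_fun [set: T] h ->
  \int[nu]_x (h x)%:E = \int[mu]_x (h x * p x)%:E.
Proof.
move=> mh; have mhE : measurable_fun [set: T] (EFin \o h) by exact/measurable_EFinP.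
rewrite integralE [RHS]integralE; congr (_ - _).
  rewrite ge0_integral_density//; last exact: measurable_funepos.
  apply: eq_integral => x _; rewrite !funeposE /= -!EFin_max -EFinM.
  by rewrite maxr_pMl// mul0r.
rewrite ge0_integral_density//; last exact: measurable_funeneg.
apply: eq_integral => x _; rewrite !funenegE /= -!EFin_max -EFinM.
by rewrite maxr_pMl// mul0r mulNr.
Qed.

End density.

Section transport.
Context d d' (T : measurableType d) (T' : measurableType d') (R : realType).
Variables (P : probability T R) (X : {RV P >-> T'}).
Local Open Scope ereal_scope.

Lemma integrable_distribution (h : T' -> R) : measurable_fun [set: T'] h ->
  P.-integrable [set: T] (EFin \o (h \o X)) <->
  (distribution P X).-integrable [set: T'] (EFin \o h).
Proof.
move=> mh.
have mX : measurable_fun [set: T] X by [].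
have E : \int[distribution P X]_x `|(h x)%:E| = \int[P]_w `|(h (X w))%:E|.
  rewrite ge0_integral_distribution//.
  by do 2 apply: measurableT_comp => //.
split=> /integrableP[_ i]; apply/integrableP; split.
- exact/measurable_EFinP.
- by rewrite /comp E.
- by apply/measurable_EFinP; exact: measurableT_comp.
- by rewrite /comp -E.
Qed.

Lemma expectation_distribution (h : T' -> R) : measurable_fun [set: T'] h ->
  P.-integrable [set: T] (EFin \o (h \o X)) ->
  'E_P[h \o X] = \int[distribution P X]_x (h x)%:E.
Proof.
move=> mh ih; rewrite unlock integral_distribution//.
exact/measurable_EFinP.
Qed.

(** The line carries two measurable structures with the same Borel sets but with
    different displays.  Lebesgue measure lives on the second one, so comparing a
    law with it requires moving the random variable there. *)
Lemma RV_measurableTypeR (X1 : {RV P >-> R}) :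
  {X' : {RV P >-> measurableTypeR R} | X' = X1 :> (T -> R)}.
Proof.
have mX : measurable_fun [set: T] (X1 : T -> measurableTypeR R).
  by move=> mT A mA; exact: measurable_funP.
pose X' : {mfun T >-> measurableTypeR R} :=
  HB.pack (X1 : T -> measurableTypeR R) (isMeasurableFun.Build _ _ _ _ _ mX).
by exists X'.
Qed.

End transport.

Section beta_probability.
Context {R : realType} (a b : R) (a1 : -1 < a) (b1 : -1 < b).
Local Open Scope ereal_scope.

Let beta_prob0 : beta_distr a b set0 = 0.
Proof. exact: integral_set0. Qed.

Let beta_prob_ge0 A : 0 <= beta_distr a b A.
Proof. by apply: integral_ge0 => x _; rewrite lee_fin beta_density_ge0. Qed.

Let beta_prob_sigma_additive :
  semi_sigma_additive (beta_distr a b : set (measurableTypeR R) -> \bar R).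
Proof.
move=> /= F mF tF mUF; apply: cvg_toP.
  apply: ereal_nondecreasing_is_cvgn => m n mn.
  apply: lee_sum_nneg_natr => // k _ _; exact: beta_prob_ge0.
rewrite /beta_distr ge0_integral_bigcup//=.
- by apply/measurable_EFinP; apply: measurable_funTS; exact: measurable_beta_density.
- move=> x _. by rewrite lee_fin beta_density_ge0.
Qed.

(** The bounds on a and b are recorded in the term so that its measure and
    probability structures can be inferred from it. *)
Definition beta_measure : set (measurableTypeR R) -> \bar R :=
  let _ := a1 in let _ := b1 in beta_distr a b.

HB.instance Definition _ := isMeasure.Build _ _ _ beta_measure
  beta_prob0 beta_prob_ge0 beta_prob_sigma_additive.

Let beta_measureT : beta_measure [set: _] = 1.
Proof. exact: integral_beta_density. Qed.

HB.instance Definition _ :=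
  @Measure_isProbability.Build _ _ _ beta_measure beta_measureT.

End beta_probability.

(** * The Pearson equation *)

Section rho.
Context {R : realType}.

Lemma tpowS (s y : R) : y * tpow s y = tpow (s + 1) y.
Proof.
have [y0|y0] := ltP 0 y; last by rewrite !tpow0// mulr0.
by rewrite !tpowE// gt0_powRD// powRr1 ?ltW// mulrC.
Qed.

Lemma is_derive_tpow (s y : R) : 0 < y ->
  is_derive y 1 (tpow s) (s * tpow (s - 1) y).
Proof.
move=> y0; rewrite tpowE//.
have e : {near y, @powR R ^~ s =1 tpow s}.
  by near=> z; rewrite tpowE//; near: z; exact: lt_nbhsr.
have [h1 h2] := is_derive1_powR s y0.
split; first exact: near_eq_derivable h1.
by rewrite -h2; apply/esym/near_eq_derive.
Unshelve. end_near. Qed.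

Lemma continuous_tpow_gt0 (s y : R) : 0 < y -> {for y, continuous (tpow s)}.
Proof.
move=> /(is_derive_tpow s)[+ _] => /derivable1_diffP.
exact: differentiable_continuous.
Qed.

Lemma continuous_tpow (s : R) : 0 < s -> continuous (tpow s).
Proof.
move=> s0 y; have [y0|y0|<-] := ltgtP 0 y.
- exact: continuous_tpow_gt0.
- rewrite /continuous_at tpow0 ?(ltW y0)//.
  have : (fun _ : R => 0 : R) x @[x --> y] --> (0 : R) by exact: cvg_cst.
  apply: cvg_trans.
  apply: near_eq_cvg; near=> z; rewrite tpow0//; apply: ltW; near: z.
  exact: lt_nbhsl.
- apply/left_right_continuousP; split.
    rewrite tpow0//.
    have : (fun _ : R => 0 : R) x @[x --> 0^'-] --> (0 : R) by exact: cvg_cst.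
    apply: cvg_trans.
    by apply: near_eq_cvg; near=> z; rewrite tpow0.
  rewrite tpow0//; apply: cvg_trans (powR_cvg0 s0).
  by apply: near_eq_cvg; near=> z; rewrite tpowE.
Unshelve. all: end_near. Qed.

Variables a b : R.

Lemma beta_rhoE (x : R) : beta_rho a b x =
  beta_const a b * (tpow (a + 1) (1 - x) * tpow (b + 1) (1 + x)).
Proof. by rewrite /beta_rho beta_densityE -!tpowS; ring. Qed.

(** Here a, b > -1 enters: the exponents a + 1 and b + 1 are positive, so rho has
    no jump at the endpoints.  This is why no boundary term appears later. *)
Lemma continuous_beta_rho : -1 < a -> -1 < b -> continuous (beta_rho a b).
Proof.
move=> a1 b1 x.
rewrite (_ : beta_rho a b = fun x => beta_const a b *
  (tpow (a + 1) (1 - x) * tpow (b + 1) (1 + x))); last first.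
  by apply/funext => y; exact: beta_rhoE.
apply: cvgM; first exact: cvg_cst.
have c s (f : R -> R) : -1 < s -> {for x, continuous f} ->
    {for x, continuous (fun z => tpow (s + 1) (f z))}.
  move=> s1 cf; apply: (continuous_comp cf).
  by apply: continuous_tpow; lra.
apply: cvgM; apply: c => //.
  by apply: cvgB; [exact: cvg_cst|exact: cvg_id].
by apply: cvgD; [exact: cvg_cst|exact: cvg_id].
Qed.

Lemma continuous_beta_density (x : R) : -1 < x < 1 ->
  {for x, continuous (beta_density a b)}.
Proof.
move=> x1.
rewrite (_ : beta_density a b = fun x => beta_const a b *
  (tpow a (1 - x) * tpow b (1 + x))); last first.
  by apply/funext => y; exact: beta_densityE.
apply: cvgM; first exact: cvg_cst.
have c s (f : R -> R) : 0 < f x -> {for x, continuous f} ->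
    {for x, continuous (fun z => tpow s (f z))}.
  move=> s1 cf; apply: (continuous_comp cf).
  exact: continuous_tpow_gt0.
apply: cvgM; apply: c; rewrite ?subr_gt0; [lra| |lra|].
  by apply: cvgB; [exact: cvg_cst|exact: cvg_id].
by apply: cvgD; [exact: cvg_cst|exact: cvg_id].
Qed.

(** As rho is a multiple of (1 - x)^(a + 1) (1 + x)^(b + 1), differentiating
    replaces a factor 1 - x or 1 + x by a constant, which leaves p times
    (b + 1) (1 - x) - (a + 1) (1 + x). *)
Lemma is_derive_beta_rho (x : R) : -1 < x < 1 ->
  is_derive x 1 (beta_rho a b)
    (- (((a + b + 2) * x + (a - b)) * beta_density a b x)).
Proof.
move=> x1.
rewrite (_ : beta_rho a b = fun x => beta_const a b *
  (tpow (a + 1) (1 - x) * tpow (b + 1) (1 + x))); last first.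
  by apply/funext => y; exact: beta_rhoE.
have y1 : 0 < 1 - x by lra.
have z1 : 0 < 1 + x by lra.
have da := is_derive_tpow (a + 1) y1.
have db := is_derive_tpow (b + 1) z1.
rewrite !addrK in da db.
have ha : is_derive x 1 (fun y : R => tpow (a + 1) (1 - y))
    (- ((a + 1) * tpow a (1 - x))).
  have d1 : is_derive x 1 (fun y : R => 1 - y) (- 1).
    by apply: is_derive_eq; ring.
  by have := is_derive1_comp (g := fun y : R => 1 - y) da d1; rewrite mulrN1.
have hb : is_derive x 1 (fun y : R => tpow (b + 1) (1 + y))
    ((b + 1) * tpow b (1 + x)).
  have d1 : is_derive x 1 (fun y : R => 1 + y) 1.
    by apply: is_derive_eq; ring.
  by have := is_derive1_comp (g := fun y : R => 1 + y) db d1; rewrite mulr1.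
apply: is_derive_eq.
rewrite beta_densityE -!tpowS /GRing.scale/=; ring.
Qed.

End rho.

(** * Piecewise continuously differentiable functions *)

Section piecewise.
Context {R : realType}.
Implicit Types (g : R -> R) (c d : R).

Definition C1_oo c d g := forall x, c < x < d ->
  derivable g x 1 /\ {for x, continuous (derive1 g)}.

Lemma is_derive_quotient g (x l : R) :
  (fun y => (g y - g x) / (y - x)) @ x^' --> l -> is_derive x 1 g l.
Proof.
move=> gl.
have h : h^-1 *: ((g \o shift x) (h *: 1) - g x) @[h --> 0^'] --> l.
  apply/cvgrPdist_le => e e0; move/cvgrPdist_le : gl => /(_ e e0).
  move=> /nbhs_ballP[/= r r0 H]; apply/nbhs_ballP; exists r => //= h hr h0.
  have := H (h + x); rewrite /ball/= opprD addrCA subrr addr0 addrK in hr *.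
  rewrite sub0r in hr => /(_ hr).
  rewrite -subr_eq0 addrK => /(_ h0).
  by rewrite /GRing.scale/= mulr1 mulrC.
split; first by apply/cvg_ex; exists l.
exact: cvg_lim h.
Qed.

(** At an interior point of I, a limit within I is a two-sided limit. *)
Lemma C1_on_oo (I : set R) g c d : C1_on I g -> `[c, d] `<=` I -> C1_oo c d g.
Proof.
move=> [dg [cdg gdg]] cdI.
have dE x : c < x < d -> is_derive x 1 g (dg x).
  move=> xcd; apply: is_derive_quotient.
  have Ix : \forall y \near x, I y.
    near=> y; apply: cdI; rewrite /= in_itv/=.
    by apply/andP; split; near: y; case/andP: xcd => ? ?;
      [exact: lt_le_nbhsr|exact: lt_le_nbhsl].
  have /gdg : I x by apply: cdI; rewrite /= in_itv/=; lra.
  apply: cvg_trans => P HP.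
  by apply: filterS2 Ix HP => y Iy /[swap] yx; apply.
have xE x : c < x < d -> (derive1 g) x = dg x.
  by move=> xcd; rewrite derive1E; have [_ ->] := dE _ xcd.
move=> x xcd; split; first by have [] := dE _ xcd.
have cd : c < d by lra.
have : {within `[c, d], continuous dg} by exact: continuous_subspaceW cdg.
move=> /(continuous_within_itvP _ cd)[ci _ _].
rewrite /prop_for /continuous_at xE//.
have : dg y @[y --> x] --> dg x by apply: ci; rewrite in_itv/= xcd.
apply: cvg_trans; apply: near_eq_cvg; near=> y.
apply/esym/xE; apply/andP; split; near: y; case/andP: xcd => ? ?;
  [exact: lt_nbhsr|exact: lt_nbhsl].
Unshelve. all: end_near. Qed.

(** Induction over the breakpoints: a property of intervals that is stable under
    concatenation holds everywhere as soon as it holds on the intervals whose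
    interior contains no breakpoint. *)
Lemma piecewise_C1_ind g (Q : R -> R -> Prop) : piecewise_C1 g ->
  (forall c, Q c c) ->
  (forall c e d, c <= e -> e <= d -> Q c e -> Q e d -> Q c d) ->
  (forall c d, c < d -> C1_oo c d g -> Q c d) ->
  forall c d, c <= d -> Q c d.
Proof.
move=> [x0 [s [ps gl gm gr]]] Q1 Qt Qo.
have piece (I : set R) c d : C1_on I g -> `[c, d] `<=` I -> c <= d -> Q c d.
  move=> gI cdI; rewrite le_eqVlt => /predU1P[->//|cd].
  by apply: Qo => //; exact: C1_on_oo cdI.
have right c d : x0 <= c -> c <= d -> Q c d.
  elim: s x0 c d ps gm gr {gl} => [x0 c d _ _ gr xc cd|x1 s IH x0 c d /=].
    apply: piece gr _ cd => x /=; rewrite !in_itv/= andbT => /andP[cx _].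
    exact: le_trans cx.
  move=> /andP[x01 ps] gm gr xc cd.
  have {}IH := IH x1 _ _ ps (fun i => gm i.+1) gr.
  have [x1c|cx1] := leP x1 c; first exact: IH.
  have left e : e <= x1 -> c <= e -> Q c e.
    move=> ex1; apply: piece (gm 0 isT) _ => x /=.
    by rewrite !in_itv/=; lra.
  have [dx1|x1d] := leP d x1; first exact: left.
  apply: (Qt _ x1); rewrite ?(ltW cx1) ?(ltW x1d)//.
    by apply: left => //; exact: ltW.
  by apply: IH => //; exact: ltW.
move=> c d cd.
have left e : e <= x0 -> c <= e -> Q c e.
  move=> ex0; apply: piece gl _ => x /=; rewrite !in_itv/=; lra.
have [xc|cx] := leP x0 c; first exact: right.
have [dx|xd] := leP d x0; first exact: left.
apply: (Qt _ x0); rewrite ?(ltW cx) ?(ltW xd)//.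
  by apply: left => //; exact: ltW.
by apply: right => //; exact: ltW.
Qed.

Variables (D : (R -> R) -> R -> R) (hD : derivative_convention D).

(** D g is the continuous function g' inside each piece, and the finitely many
    endpoints, where its values are arbitrary, do not affect measurability. *)
Lemma measurable_piecewise_C1 g : piecewise_C1 g ->
  measurable_fun [set: R] (D g).
Proof.
move=> pg.
have H c d : c <= d -> measurable_fun `[c, d] (D g).
  apply: (piecewise_C1_ind (Q := fun c d => measurable_fun `[c, d] (D g)) pg).
  - by move=> {}c; rewrite set_itv1; exact: measurable_fun_set1.
  - move=> {}c e {}d ce ed m1 m2.
    rewrite (_ : `[c, d]%classic = `[c, e] `|` `[e, d]).
      by apply/measurable_funU.
    apply/seteqP; split => x /=; rewrite !in_itv/=; last by case; lra.
    by have [xe|xe] := leP x e; [left|right]; lra.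
  - move=> {}c {}d cd g1.
    apply: (@measurable_fun_itv_cc _ _ _ false true).
    apply: open_continuous_measurable_fun; first exact: interval_open.
    move=> x; rewrite inE/= in_itv/= => xcd.
    have [gx cg] := g1 _ xcd.
    rewrite /continuous_at (hD gx).
    apply: cvg_trans cg; apply: near_eq_cvg; near=> y.
    apply/esym/hD; have [|//] := g1 y.
    by apply/andP; split; near: y; case/andP: xcd => ? ?;
      [exact: lt_nbhsr|exact: lt_nbhsl].
rewrite (_ : [set: R] = \bigcup_n `[- n%:R, n%:R]%classic).
  apply/measurable_fun_bigcup => // n; apply: H.
  by rewrite lerNl (le_trans (_ : _ <= 0)) ?oppr_le0.
apply/seteqP; split => // x _; exists (Num.truncn `|x|).+1 => //=.
by rewrite in_itv/= -ler_norml; exact/ltW/truncnS_gt.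
Unshelve. all: end_near. Qed.

End piecewise.

(** * The Beta law satisfies the Stein identity *)

(** X is a bare function: the identity will be used for a random variable seen
    in either of the two measurable structures on the line. *)
Definition stein_identity {R : realType} (D : (R -> R) -> R -> R) (a b : R)
    d (T : measurableType d) (P : probability T R) (X : T -> R) (g : R -> R) :=
  let Y := fun w : T => (1 - X w ^+ 2) * D g (X w) in
  let Z := fun w : T => (a + b + 2) * X w * g (X w) + (a - b) * g (X w) in
  [/\ P.-integrable [set: T] (EFin \o Y),
      P.-integrable [set: T] (EFin \o Z) & ('E_P[Y] = 'E_P[Z])%E].

Section forward.
Context {R : realType} (a b : R) (a1 : -1 < a) (b1 : -1 < b).
Variables (D : (R -> R) -> R -> R) (hD : derivative_convention D).
Notation mu := (@lebesgue_measure R).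
Notation p := (beta_density a b).
Notation rho := (beta_rho a b).
Let drift (x : R) : R := (a + b + 2) * x + (a - b).

Lemma beta_rho_ge0 (x : R) : 0 <= rho x.
Proof.
by rewrite beta_rhoE mulr_ge0 ?beta_const_ge0// mulr_ge0 ?tpow_ge0.
Qed.

Lemma beta_density_out (x : R) : ~ (-1 < x < 1) -> p x = 0.
Proof.
move=> x1; rewrite /beta_density indicE memNset ?mulr0//= in_itv/=.
Qed.

Lemma beta_rho_out (x : R) : ~ (-1 < x < 1) -> rho x = 0.
Proof. by move=> /beta_density_out p0; rewrite /beta_rho p0 mulr0. Qed.

Lemma integrable_beta_density : mu.-integrable [set: R] (fun x => (p x)%:E).
Proof.
apply/integrableP; split; first by apply/measurable_EFinP; exact: measurable_beta_density.
under eq_integral do rewrite abse_EFin ger0_norm ?beta_density_ge0//.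
by rewrite integral_beta_density// ltry.
Qed.

Lemma integrable_bounded_beta_density (f : R -> R) (M : R) :
  measurable_fun [set: R] f -> (forall x, -1 < x < 1 -> `|f x| <= M) ->
  mu.-integrable [set: R] (fun x => (f x * p x)%:E).
Proof.
move=> mf fM.
apply: (@le_integrable _ _ _ mu _ measurableT _ (fun x => (M * p x)%:E)) => //.
- apply/measurable_EFinP; apply: measurable_funM => //.
  exact: measurable_beta_density.
- move=> x _; rewrite !abse_EFin lee_fin (normrM (f x)) (normrM M).
  have [x1|/negP x1] := boolP (-1 < x < 1).
    rewrite ler_wpM2r//; apply: le_trans (fM _ x1) _; exact: ler_norm.
  by rewrite beta_density_out ?normr0 ?mulr0.
- under eq_fun do rewrite EFinM.
  by apply: integrableZl => //; exact: integrable_beta_density.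
Qed.

Variable (g : R -> R) (gK : classK D a b g).

Let cg : continuous g. Proof. by case: gK. Qed.

Let measurable_drift : measurable_fun [set: R] drift.
Proof. by apply: measurable_funD => //; exact: measurable_funM. Qed.

Let mg : measurable_fun [set: R] g.
Proof. exact: continuous_measurable_fun. Qed.

Let mDg : measurable_fun [set: R] (D g).
Proof. by apply: measurable_piecewise_C1 => //; case: gK. Qed.

Let integrable_Dg : mu.-integrable [set: R] (fun x => (D g x * rho x)%:E).
Proof.
case: gK => _ _ _ i; apply/integrableP; split.
  apply/measurable_EFinP; apply: measurable_funM => //.
  by apply: continuous_measurable_fun; exact: continuous_beta_rho.
under eq_integral do rewrite abse_EFin (normrM (D g _)) (ger0_norm (beta_rho_ge0 _)).
exact: i.
Qed.

Let integrable_g : mu.-integrable [set: R] (fun x => (drift x * g x * p x)%:E).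
Proof.
have [M [_ gM]] : bounded_set (g @` `[-1, 1]).
  apply: compact_bounded; apply: continuous_compact; last exact: segment_compact.
  exact: continuous_subspaceT.
apply: (@integrable_bounded_beta_density _
    ((`|a + b + 2| + `|a - b|) * (M + 1))).
  exact: measurable_funM.
move=> x x1; rewrite (normrM (drift x)) ler_pM//.
  rewrite (le_trans (ler_normD _ _))// lerD2r normrM ler_piMr// ler_norml; lra.
by apply: gM; [rewrite ltrDl|exists x => //; rewrite /= in_itv/=; lra].
Qed.

(** The function S(x) = int_(-1)^x H - g(x) rho(x), with H = g' rho - drift g p,
    is continuous on [-1, 1].  Inside a piece its derivative
    H - g' rho - g rho' is zero by the Pearson equation, so S is constant on
    [-1, 1]; as rho vanishes at both ends, comparing S(-1) with S(1) gives
    int H = 0. *)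
Lemma beta_integration_by_parts :
  (\int[mu]_x (D g x * rho x)%:E = \int[mu]_x (drift x * g x * p x)%:E)%E.
Proof.
have [H HE] : exists H : R -> R,
    H = fun x => D g x * rho x - drift x * g x * p x by eexists.
have iH : mu.-integrable [set: R] (EFin \o H).
  rewrite HE /comp; under eq_fun do rewrite EFinB.
  exact: integrableB.
suff H0 : (\int[mu]_x (H x)%:E = 0)%E.
  move: H0; rewrite HE; under eq_integral do rewrite EFinB.
  rewrite integralB//.
  have := integrable_fin_num measurableT integrable_Dg.
  have := integrable_fin_num measurableT integrable_g.
  do 2 case: (integral _ _ _) => //= ?.
  by move=> _ _ [] /eqP; rewrite subr_eq0 => /eqP ->.
have iH1 u : mu.-integrable `[-1, u] (EFin \o H).
  by apply: integrableS iH.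
have [G [cG GN1 G1 GD]] : exists G : R -> R,
    [/\ {within `[-1, 1], continuous G}, G (-1) = 0,
      (G 1)%:E = (\int[mu]_(x in `[(-1)%R, 1%R]) (H x)%:E)%E &
      forall x, -1 < x < 1 -> {for x, continuous H} -> is_derive x 1 G (H x)].
  exists (fun x => \int[mu]_(t in `[(-1)%R, x]) H t)%R; split.
  - by apply: parameterized_integral_continuous; [lra|exact: iH1].
  - by rewrite set_itv1 Rintegral_set1.
  - by rewrite /Rintegral fineK//; exact: integrable_fin_num.
  - move=> x /andP[xN1 x1] cH.
    have [dG GE] := continuous_FTC1_closed x1 (iH1 1) xN1 cH.
    by apply: DeriveDef => //; rewrite -derive1E.
pose S x := G x - g x * rho x.
have cS : {within `[-1, 1], continuous S}.
  have cgr : {within `[-1, 1], continuous (g * rho)}.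
    apply: continuous_subspaceT => x; apply: cvgM; first exact: cg.
    exact: continuous_beta_rho.
  by move=> x; apply: cvgB; [exact: cG|exact: cgr].
have Scst c d : c <= d -> -1 <= c -> d <= 1 -> S c = S d.
  case: gK => _ pg _ _.
  apply: (piecewise_C1_ind (Q := fun c d => -1 <= c -> d <= 1 -> S c = S d) pg).
  - by [].
  - move=> {}c e {}d ce ed h1 h2 c1 d1.
    by rewrite h1 ?h2//; lra.
  - move=> {}c {}d cd gcd c1 d1.
    have Sd x : x \in `]c, d[ -> is_derive x 1 S 0.
      rewrite in_itv/= => xcd.
      have [dg cdg] := gcd _ xcd.
      have x1 : -1 < x < 1 by lra.
      have cDg : {for x, continuous (D g)}.
        rewrite /prop_for /continuous_at (hD dg).
        apply: cvg_trans cdg; apply: near_eq_cvg; near=> y.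
        apply/esym/hD; have [|//] := gcd y.
        by apply/andP; split; near: y; case/andP: xcd => ? ?;
          [exact: lt_nbhsr|exact: lt_nbhsl].
      have cH : {for x, continuous H}.
        rewrite HE.
        apply: cvgB; first by apply: cvgM => //; exact: continuous_beta_rho.
        apply: cvgM; last exact: continuous_beta_density.
        apply: cvgM; last exact: cg.
        by apply: cvgD; [apply: cvgM; [exact: cvg_cst|exact: cvg_id]|exact: cvg_cst].
      have iG := GD x x1 cH.
      have ig : is_derive x 1 g (D g x).
        by apply: DeriveDef; [exact: dg|rewrite (hD dg) derive1E].
      have ir := is_derive_beta_rho a b x1.
      have iS := is_deriveB iG (is_deriveM ig ir).
      apply: (is_derive_eq iS).
      by rewrite HE /GRing.scale/= /drift; ring.
    have [] := @MVT R S (fun=> 0) c d cd Sd.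
    - apply: continuous_subspaceW cS => x /=; rewrite !in_itv/=; lra.
    - by move=> ? _; rewrite mul0r => /eqP; rewrite subr_eq0 => /eqP.
have S11 : S (-1) = S 1 by apply: Scst; lra.
have G10 : G 1 = 0.
  have rN : rho (-1) = 0 by rewrite beta_rho_out// ltxx.
  have r1 : rho 1 = 0 by rewrite beta_rho_out// ltxx andbF.
  by move: S11; rewrite /S rN r1 !mulr0 !subr0 GN1.
rewrite -[RHS]/(0%:E) -G10 G1.
rewrite [RHS]integral_mkcond; apply: eq_integral => x _.
rewrite patchE; case: ifPn => // /negP; rewrite inE/= in_itv/= => x1.
rewrite HE beta_rho_out ?beta_density_out ?mulr0 ?subrr//; lra.
Unshelve. all: end_near. Qed.

Lemma beta_stein_identity d (T : measurableType d) (P : probability T R)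
    (X : {RV P >-> measurableTypeR R}) :
  (forall A, measurable A -> distribution P X A = beta_distr a b A) ->
  stein_identity D a b P X g.
Proof.
move=> hX Y Z.
pose y (x : measurableTypeR R) : R := (1 - x ^+ 2) * D g x.
pose z (x : measurableTypeR R) : R := drift x * g x.
have mp : measurable_fun [set: measurableTypeR R] p by exact: measurable_beta_density.
have p0 x := @beta_density_ge0 R a b x a1 b1.
have my : measurable_fun [set: measurableTypeR R] y.
  by apply: measurable_funM => //; apply: measurable_funB.
have mz : measurable_fun [set: measurableTypeR R] z by exact: measurable_funM.
have YE : Y = y \o X by [].
have ZE : Z = z \o X by apply/funext => w; rewrite /Z /z /drift/=; ring.
have yE x : (y x * p x)%:E = (D g x * rho x)%:E.
  by rewrite /y /beta_rho; congr EFin; ring.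
have iY : P.-integrable [set: T] (EFin \o Y).
  rewrite YE; apply/integrable_distribution => //.
  have [_] := integrable_density (mu := mu) mp p0 hX my; apply.
  by under eq_fun do rewrite yE.
have iZ : P.-integrable [set: T] (EFin \o Z).
  rewrite ZE; apply/integrable_distribution => //.
  by have [_] := integrable_density (mu := mu) mp p0 hX mz; apply.
split => //.
rewrite YE ZE !expectation_distribution -?YE -?ZE//.
rewrite (integral_density (mu := mu) mp p0 hX)//.
rewrite (integral_density (mu := mu) mp p0 hX)//.
by under eq_integral do rewrite yE; exact: beta_integration_by_parts.
Qed.

End forward.

(** * Test functions glued at the endpoints *)

Section glue.
Context {R : realType}.
Implicit Types (f g : R -> R) (x y l : R).

Lemma quotient_is_derive f x l : is_derive x 1 f l ->
  (f y - f x) / (y - x) @[y --> x^'] --> l.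
Proof.
move=> [df dfl].
have : h^-1 *: ((f \o shift x) (h *: 1) - f x) @[h --> 0^'] --> l.
  by rewrite -dfl.
move=> /cvgrPdist_le h; apply/cvgrPdist_le => e e0; move: h => /(_ e e0).
move=> /nbhs_ballP[/= r r0 H]; apply/nbhs_ballP; exists r => //= y yr yx.
have := H (y - x); rewrite /ball/= sub0r normrN distrC.
move=> /(_ yr); rewrite subr_eq0 => /(_ yx).
by rewrite /GRing.scale/= mulr1 subrK mulrC.
Qed.

Lemma C1_on_is_derive (I : set R) f df g :
  (forall x, I x -> g x = f x) -> (forall x, I x -> is_derive x 1 f (df x)) ->
  (forall x, I x -> {for x, continuous df}) -> C1_on I g.
Proof.
move=> gf fdf cdf; exists df; split.
  by apply: continuous_in_subspaceT => x; rewrite inE; exact: cdf.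
move=> x Ix.
have h : (f y - f x) / (y - x) @[y --> within I x^'] --> df x.
  by apply: cvg_within_filter; exact/quotient_is_derive/fdf.
apply: cvg_trans h; apply: near_eq_cvg; near=> y.
by rewrite !gf//; near: y; exact: withinT.
Unshelve. all: end_near. Qed.

Variables (gi go dgi dgo : R -> R).
Hypothesis gid : forall x, is_derive x 1 gi (dgi x).
Hypothesis cdgi : continuous dgi.
Hypothesis god : forall x, x != 0 -> is_derive x 1 go (dgo x).
Hypothesis cdgo : forall x, x != 0 -> {for x, continuous dgo}.
Hypothesis gio1 : gi 1 = go 1.
Hypothesis gioN1 : gi (-1) = go (-1).
Hypothesis goy : go x @[x --> +oo] --> 0.
Hypothesis goNy : go x @[x --> -oo] --> 0.

(** Truncating the arguments makes continuity at -1 and 1 automatic.  As go is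
    evaluated only where the argument has absolute value at least 1, it may be
    singular at 0. *)
Definition glue (x : R) : R :=
  gi (Num.max (-1) (Num.min 1 x)) + (go (Num.max 1 x) - go 1) +
  (go (Num.min (-1) x) - go (-1)).

Definition dglue (x : R) : R := if `|x| <= 1 then dgi x else dgo x.

Lemma glue_in x : `|x| <= 1 -> glue x = gi x.
Proof.
rewrite ler_norml => /andP[x1 x2].
rewrite /glue (min_r x2) (max_r x1) (max_l x2) (min_l x1).
by ring.
Qed.

Lemma glue_ge1 x : 1 <= x -> glue x = go x.
Proof.
move=> x1; rewrite /glue (min_l x1) (max_r x1) max_r ?min_l; [|lra..].
by rewrite gio1; ring.
Qed.

Lemma glue_leN1 x : x <= -1 -> glue x = go x.
Proof.
move=> x1; rewrite /glue (@min_r _ _ 1) ?(max_l x1) ?(min_r x1) ?max_l; [|lra..].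
by rewrite gioN1; ring.
Qed.

Lemma glue_out x : 1 <= `|x| -> glue x = go x.
Proof.
by rewrite ler_normr lerNr => /orP[/glue_ge1//|/glue_leN1].
Qed.

Lemma continuous_glue : continuous glue.
Proof.
have co x : x != 0 -> {for x, continuous go}.
  by move=> /god[+ _] => /derivable1_diffP; exact: differentiable_continuous.
have ci x : {for x, continuous gi}.
  by have [+ _] := gid x => /derivable1_diffP; exact: differentiable_continuous.
have cid x : {for x, continuous (@id R)} by exact: cvg_id.
have cc (c x : R) : {for x, continuous (fun _ : R => c)} by exact: cvg_cst.
move=> x.
have h1 : {for x, continuous (fun y => gi (Num.max (-1) (Num.min 1 y)))}.
  apply: (@continuous_comp _ _ _ (fun y => Num.max (-1) (Num.min 1 y)) gi) => //.
  by apply: continuous_max => //; exact: continuous_min.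
have h2 : {for x, continuous (fun y => go (Num.max 1 y))}.
  apply: (@continuous_comp _ _ _ (fun y => Num.max 1 y) go).
    exact: continuous_max.
  by apply: co; rewrite gt_eqF// lt_max ltr01.
have h3 : {for x, continuous (fun y => go (Num.min (-1) y))}.
  apply: (@continuous_comp _ _ _ (fun y => Num.min (-1) y) go).
    exact: continuous_min.
  by apply: co; rewrite lt_eqF// gt_min ltrN10.
have h4 := continuousD (continuousD h1 (continuousB h2 (cc (go 1) x)))
  (continuousB h3 (cc (go (-1)) x)).
exact: h4.
Qed.

Lemma piecewise_C1_glue : piecewise_C1 glue.
Proof.
exists (-1), [:: 1]; split => /=.
- by rewrite andbT; lra.
- apply: (@C1_on_is_derive _ go dgo) => x; rewrite /= in_itv/=.
  + exact: glue_leN1.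
  + by move=> x1; apply: god; rewrite lt_eqF//; lra.
  + by move=> x1; apply: cdgo; rewrite lt_eqF//; lra.
- move=> [|//] _ /=; apply: (@C1_on_is_derive _ gi dgi) => x; rewrite /= in_itv/=.
  + by move=> x1; apply: glue_in; rewrite ler_norml.
  + by move=> _; exact: cdgi.
- apply: (@C1_on_is_derive _ go dgo) => x; rewrite /= in_itv/= andbT.
  + exact: glue_ge1.
  + by move=> x1; apply: god; rewrite gt_eqF//; lra.
  + by move=> x1; apply: cdgo; rewrite gt_eqF//; lra.
Qed.

Lemma is_derive_glue x : `|x| != 1 -> is_derive x 1 glue (dglue x).
Proof.
move=> x1; rewrite /dglue; case: leP => x1'.
  have xlt : `|x| < 1 by rewrite lt_neqAle x1.
  have e : {near x, gi =1 glue}.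
    near=> y; rewrite glue_in// ltW//; near: y.
    by apply: (@cvgr_norm_lt _ _ _ _ _ id x) => //; exact: cvg_id.
  have [h1 h2] := gid x; split; first exact: near_eq_derivable h1.
  by rewrite -h2; apply/esym/near_eq_derive.
have e : {near x, go =1 glue}.
  near=> y; rewrite glue_out// ltW//; near: y.
  by apply: (@cvgr_norm_gt _ _ _ _ _ id x) => //; exact: cvg_id.
have x0 : x != 0 by rewrite -normr_gt0 (lt_trans _ x1').
have [h1 h2] := god x0; split; first exact: near_eq_derivable h1.
by rewrite -h2; apply/esym/near_eq_derive.
Unshelve. all: end_near. Qed.

Context (a b : R) (a1 : -1 < a) (b1 : -1 < b).
Variables (D : (R -> R) -> R -> R) (hD : derivative_convention D).

Lemma D_glue x : `|x| != 1 -> D glue x = dglue x.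
Proof.
by move=> /is_derive_glue[d1 d2]; rewrite hD// derive1E.
Qed.

(** The factor 1 - x^2 removes the two breakpoints, where the value of D is
    arbitrary and where X might have an atom. *)
Lemma D_glueM x : (1 - x ^+ 2) * D glue x = (1 - x ^+ 2) * dglue x.
Proof.
have [x1|] := eqVneq (`|x|) 1; last by move/D_glue => ->.
by rewrite -real_normK ?num_real// x1 expr1n subrr !mul0r.
Qed.

(** Since rho vanishes off ]-1, 1[, the weighted integrability of the derivative
    only concerns gi, whose derivative is bounded there. *)
Lemma classK_glue : classK D a b glue.
Proof.
split; [exact: continuous_glue|exact: piecewise_C1_glue| |].
- split.
    apply: cvg_trans goy; apply: near_eq_cvg; near=> x.
    by rewrite glue_ge1//; near: x; exact: nbhs_pinfty_ge.
  apply: cvg_trans goNy; apply: near_eq_cvg; near=> x.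
  by rewrite glue_leN1//; near: x; exact: nbhs_ninfty_le.
have [M [_ gM]] : bounded_set (dgi @` `[-1, 1]).
  apply: compact_bounded; apply: continuous_compact; last exact: segment_compact.
  exact: continuous_subspaceT.
have E x : `|D glue x| * beta_rho a b x =
    `| `|dgi x| * (1 - x ^+ 2) * beta_density a b x|.
  rewrite -(mulrA (`|dgi x|)) -/(beta_rho a b x) (normrM (`|dgi x|)) normr_id.
  rewrite (ger0_norm (beta_rho_ge0 _ _ _))//.
  have [x1|/negP x1] := boolP (-1 < x < 1); last by rewrite beta_rho_out ?mulr0.
  have x1' : `|x| < 1 by rewrite ltr_norml.
  by rewrite D_glue ?lt_eqF// /dglue ltW.
under eq_integral do rewrite E -abse_EFin.
suff /integrableP[] : lebesgue_measure.-integrable [set: R]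
    (fun x => (`|dgi x| * (1 - x ^+ 2) * beta_density a b x)%:E) by [].
apply: (integrable_bounded_beta_density a1 b1 (M := M + 1)).
  apply: measurable_funM; last exact: measurable_funB.
  by apply: measurableT_comp => //; exact: continuous_measurable_fun.
move=> x x1; rewrite normrM normr_id -[leRHS]mulr1 ler_pM//.
  by apply: gM; [rewrite ltrDl|exists x => //; rewrite /= in_itv/=; lra].
rewrite ler_norml; apply/andP; split; nra.
Unshelve. all: end_near. Qed.

(** The Stein operator (1 - x^2) g' - ((a + b + 2) x + a - b) g at g = glue. *)
Definition glue_stein_op x : R :=
  (1 - x ^+ 2) * dglue x - ((a + b + 2) * x + (a - b)) * glue x.

Lemma glue_stein d (T : measurableType d) (P : probability T R) (X : T -> R) :
  (forall g, classK D a b g -> stein_identity D a b P X g) ->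
  P.-integrable [set: T] (fun w => (glue_stein_op (X w))%:E) /\
  (\int[P]_w (glue_stein_op (X w))%:E = 0)%E.
Proof.
move=> /(_ _ classK_glue)[].
set Y := (fun w => (1 - _) * _); set Z := (fun w => _ + _) => iY iZ EYZ.
have E w : (glue_stein_op (X w))%:E = ((Y w)%:E - (Z w)%:E)%E.
  by rewrite /Y D_glueM -EFinB /glue_stein_op /Z; congr EFin; ring.
split.
  by under eq_fun do rewrite E; exact: integrableB.
under eq_integral do rewrite E.
rewrite integralB//; move: EYZ; rewrite unlock => <-.
by rewrite subee//; exact: integrable_fin_num.
Qed.

End glue.

(** * The Stein identity confines the law *)

Section support.
Context {R : realType} (a b : R) (a1 : -1 < a) (b1 : -1 < b).
Variables (D : (R -> R) -> R -> R) (hD : derivative_convention D).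
Let kappa := a + b + 2.
Let eps := kappa / 2.
Let r := (3 + eps) / 2.

Let eps_gt0 : 0 < eps.
Proof. by move: a1 b1 => ? ?; rewrite /eps divr_gt0// /kappa; lra. Qed.

(** Up to sign, the tail is of size |x|^(-eps) at infinity with
    eps < kappa.  Off [-1, 1] the solutions of the homogeneous equation
    (1 - x^2) g' = ((a + b + 2) x + a - b) g are of size |x|^(-kappa); decaying
    more slowly than these is what gives the Stein operator a strict sign. *)
Let tail (x : R) : R := x * (x ^+ 2 - 1) * (x ^+ 2) `^ (- r).
Let dtail (x : R) : R := (x ^+ 2) `^ (- r) * (2 + eps - eps * x ^+ 2).

Lemma is_derive_tail (x : R) : x != 0 -> is_derive x 1 tail (dtail x).
Proof.
move=> x0; have x20 : 0 < x ^+ 2 by rewrite exprn_even_gt0.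
have dp := is_derive1_powR (- r) x20.
have d2 : is_derive x 1 (fun y : R => y ^+ 2) (2 * x).
  by apply: is_derive_eq; rewrite /GRing.scale/=; ring.
have dq : is_derive x 1 (fun y : R => (y ^+ 2) `^ (- r))
    (- r * (x ^+ 2) `^ (- r - 1) * (2 * x)).
  exact: (is_derive1_comp (g := fun y : R => y ^+ 2) dp d2).
have dc : is_derive x 1 (fun y : R => y * (y ^+ 2 - 1)) (3 * x ^+ 2 - 1).
  by apply: is_derive_eq; rewrite /GRing.scale/= ?mulr1 ?expr1; ring.
apply: (is_derive_eq (is_deriveM dc dq)).
rewrite /GRing.scale/= /dtail.
have -> : (x ^+ 2) `^ (- r) = (x ^+ 2) `^ (- r - 1) * x ^+ 2.
  by rewrite -[in RHS](powRr1 (ltW x20)) -powRrM mul1r -gt0_powRD// subrK.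
by rewrite /r; field.
Qed.

Lemma continuous_dtail (x : R) : x != 0 -> {for x, continuous dtail}.
Proof.
move=> x0; have x20 : 0 < x ^+ 2 by rewrite exprn_even_gt0.
have cX : {for x, continuous (fun y : R => y ^+ 2)} by exact: exprn_continuous.
apply: cvgM.
  apply: (@continuous_comp _ _ _ (fun y : R => y ^+ 2) (@powR R ^~ (- r)) x cX).
  have [+ _] := is_derive1_powR (- r) x20 => /derivable1_diffP.
  exact: differentiable_continuous.
apply: cvgB; first exact: cvg_cst.
by apply: cvgM; [exact: cvg_cst|exact: cX].
Qed.

Lemma tailN (x : R) : tail (- x) = - tail x.
Proof. by rewrite /tail sqrrN !mulNr. Qed.

Lemma cvgy_tail : tail x @[x --> +oo] --> 0.
Proof.
apply/cvgrPdist_le => e e0.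
near=> x.
have x1 : 1 <= x by near: x; exact: nbhs_pinfty_ge.
have x0 : 0 < x by lra.
have xM : (e^-1) `^ (eps^-1) <= x by near: x; exact: nbhs_pinfty_ge.
have xe : e^-1 <= x `^ eps.
  have := ge0_ler_powR (ltW eps_gt0) (powR_ge0 _ _) (ltW x0) xM.
  by rewrite -powRrM mulVf ?gt_eqF// powRr1// invr_ge0 ltW.
rewrite sub0r normrN ger0_norm; last first.
  rewrite /tail mulr_ge0 ?powR_ge0// mulr_ge0 ?(ltW x0)// subr_ge0.
  by rewrite exprn_ege1.
rewrite /tail; have -> : (x ^+ 2) `^ (- r) = x `^ (2 * (- r)).
  by rewrite powRrM powR_mulrn ?(ltW x0).
apply: (@le_trans _ _ (x ^+ 3 * x `^ (2 * - r))).
  rewrite ler_wpM2r ?powR_ge0// [leRHS]exprS ler_wpM2l ?(ltW x0)//.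
  by rewrite lerBlDr lerDl.
rewrite -powR_mulrn ?(ltW x0)// -gt0_powRD//.
rewrite (_ : 3 + 2 * - r = - eps); last by rewrite /r; field.
rewrite powRN -[leRHS]invrK lef_pV2// posrE ?invr_gt0// powR_gt0//.
Unshelve. all: end_near. Qed.

Lemma cvgNy_tail : tail x @[x --> -oo] --> 0.
Proof.
apply/cvgNy_compNP.
rewrite (_ : _ \o _ = (fun x => - tail x)); last first.
  by apply/funext => x; rewrite /= tailN.
have h := cvgN cvgy_tail; rewrite oppr0 in h.
exact: h.
Qed.

(** The Stein operator L of the tail, continued by 0 to [-1, 1], vanishes on
    [-1, 1] and is negative outside.  As E[L(X)] = 0, no mass is left outside. *)
Lemma stein_support d (T : measurableType d) (P : probability T R)
    (X : {RV P >-> measurableTypeR R}) :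
  (forall g, classK D a b g -> stein_identity D a b P X g) ->
  {ae P, forall w, `|X w| <= 1}.
Proof.
move=> hst.
have gi (x : R) : is_derive x 1 (fun _ : R => 0 : R) (0 : R) by exact: is_derive_cst.
have cgi : continuous (fun _ : R => 0 : R) by move=> x; exact: cvg_cst.
have t1 : (0 : R) = tail 1 by rewrite /tail expr1n subrr mulr0 mul0r.
have tN1 : (0 : R) = tail (-1) by rewrite tailN -t1 oppr0.
have [] := glue_stein gi cgi is_derive_tail continuous_dtail t1 tN1
  cvgy_tail cvgNy_tail a1 b1 hD hst.
set L := glue_stein_op _ _ _ _ _ _ => iL L0.
have Lin x : `|x| <= 1 -> L x = 0.
  by move=> x1; rewrite /L /glue_stein_op glue_in// /dglue x1 !mulr0 subrr.
have Lout x : 1 < `|x| -> L x < 0.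
  move=> x1.
  have x2 : 1 < x ^+ 2 by rewrite -real_normK ?num_real// exprn_egt1.
  rewrite /L /glue_stein_op (glue_out t1 tN1 (ltW x1)) /dglue leNgt x1/= /dtail /tail.
  have q0 : 0 < (x ^+ 2) `^ (- r) by rewrite powR_gt0//; lra.
  rewrite (_ : _ - _ = - ((x ^+ 2 - 1) * (x ^+ 2) `^ (- r) *
    (eps * x ^+ 2 + (a - b) * x + 2 + eps))); last first.
    by rewrite /eps /kappa; field.
  rewrite oppr_lt0 mulr_gt0//; first by rewrite mulr_gt0//; lra.
  (* positive because a + 1 and b + 1 are *)
  rewrite (_ : _ + eps =
      (a + 1) / 2 * (x + 1) ^+ 2 + (b + 1) / 2 * (x - 1) ^+ 2 + 2).
    rewrite ltr_wpDl// addr_ge0// mulr_ge0 ?sqr_ge0// divr_ge0//.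
      by rewrite -(addNr 1) lerD2r ltW.
    by rewrite -(addNr 1) lerD2r ltW.
  by rewrite /eps /kappa; field.
have L_le0 x : L x <= 0.
  by have [/Lin ->//|/Lout/ltW] := leP `|x| 1.
have : (\int[P]_w `|(L (X w))%:E| = 0)%E.
  under eq_integral do rewrite abse_EFin ler0_norm// EFinN.
  by rewrite integralN/= ?L0 ?oppe0//; exact: integrable_add_def.
move/ae_eq_integral_abs => []//; first exact: measurable_int iL.
move=> N [mN N0 sN]; exists N; split => // w /= Xw; apply: sN => /= h.
apply: Xw; rewrite leNgt; apply/negP => /Lout.
by have [->] := h I; rewrite ltxx.
Qed.

End support.

(** * The Stein identity determines the moments *)

Section moments.
Context {R : realType}.

Definition clamp (x : R) : R := Num.max (-1) (Num.min 1 x).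

Lemma norm_clamp_le1 x : `|clamp x| <= 1.
Proof.
by rewrite ler_norml /clamp le_max lexx/= ge_max ge_min lexx/=; lra.
Qed.

Lemma clamp_id x : `|x| <= 1 -> clamp x = x.
Proof.
by rewrite ler_norml => /andP[x1 x2]; rewrite /clamp min_r// max_r.
Qed.

Lemma continuous_clamp : continuous clamp.
Proof.
have cid (x : R) : {for x, continuous (@id R)} by exact: cvg_id.
have cc (c x : R) : {for x, continuous (fun _ : R => c)} by exact: cvg_cst.
move=> x.
suff h : {for x, continuous (fun y : R => Num.max (-1) (Num.min 1 y))} by exact: h.
by apply: continuous_max => //; exact: continuous_min.
Qed.

Lemma is_derive_expr n (x : R) :
  is_derive x 1 (fun y : R => y ^+ n) (n%:R * x ^+ n.-1).
Proof.
apply: DeriveDef; first exact: exprn_derivable.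
by rewrite exp_derive /GRing.scale/= mulr1.
Qed.

Lemma is_derive_invexpr n (x : R) : x != 0 ->
  is_derive x 1 (fun y : R => y^-1 ^+ n) (- (n%:R * x^-1 ^+ n.+1)).
Proof.
move=> x0.
have dV : is_derive x 1 (fun y : R => y^-1) (- x ^- 2).
  have did : is_derive x 1 (@id R) 1 by exact: is_derive_id.
  have := is_deriveV x0 did.
  by move/is_derive_eq; apply; rewrite /GRing.scale/= mulr1.
have := is_derive1_comp (is_derive_expr n x^-1) dV.
move/is_derive_eq; apply.
by rewrite -exprVn; case: n => [|n] /=; rewrite ?mul0r ?oppr0// !exprS; ring.
Qed.

Lemma cvgy_invexpr n : (x^-1 ^+ n.+1 : R) @[x --> +oo] --> (0 : R).
Proof.
apply/cvgrPdist_le => e e0; near=> x.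
have x1 : 1 <= x by near: x; exact: nbhs_pinfty_ge.
have x0 : 0 < x by lra.
have xe : e^-1 <= x by near: x; apply: nbhs_pinfty_ge; exact: num_real.
rewrite sub0r normrN ger0_norm; last by rewrite exprn_ge0// invr_ge0 (ltW x0).
rewrite exprS (@le_trans _ _ x^-1)//; last first.
  by rewrite -[leRHS]invrK lef_pV2 ?posrE ?invr_gt0.
by rewrite ler_piMr ?invr_ge0 ?(ltW x0)// exprn_ile1 ?invr_ge0 ?(ltW x0)// invf_le1.
Unshelve. all: end_near. Qed.

Lemma cvgNy_invexpr n : (x^-1 ^+ n.+1 : R) @[x --> -oo] --> (0 : R).
Proof.
apply/cvgNy_compNP; apply/norm_cvg0P.
have := @cvgy_invexpr n.
apply: cvg_trans; apply: near_eq_cvg; near=> x.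
have x0 : 0 < x by near: x; exact: nbhs_pinfty_gt.
by rewrite /= invrN exprNn normrM normrX normrN1 expr1n mul1r
  ger0_norm// exprn_ge0// invr_ge0 ltW.
Unshelve. all: end_near. Qed.

Context d (T : measurableType d) (P : probability T R)
    (X : {RV P >-> measurableTypeR R}).

(** Clamping makes all moments finite and does not change the law of a variable
    with values in [-1, 1]. *)
Definition moment (n : nat) : R := (\int[P]_w (clamp (X w) ^+ n))%R.

Lemma measurable_clampX : measurable_fun [set: T] (fun w => clamp (X w)).
Proof.
apply: (measurableT_comp (f := clamp : measurableTypeR R -> R)) => //.
exact: (continuous_measurable_fun continuous_clamp).
Qed.

Lemma integrable_clampX (f : R -> R) : continuous f ->
  P.-integrable [set: T] (fun w => (f (clamp (X w)))%:E).
Proof.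
move=> cf.
have [M [_ fM]] : bounded_set (f @` `[-1, 1]).
  apply: compact_bounded; apply: continuous_compact; last exact: segment_compact.
  exact: continuous_subspaceT.
apply: (@le_integrable _ _ _ _ _ measurableT _ (fun=> (M + 1)%:E)).
- apply/measurable_EFinP; apply: measurableT_comp measurable_clampX.
  exact: continuous_measurable_fun.
- move=> w _; rewrite !abse_EFin lee_fin; apply: le_trans (ler_norm _).
  apply: fM; first by rewrite ltrDl.
  by exists (clamp (X w)) => //=; rewrite in_itv/= -ler_norml norm_clamp_le1.
- exact: finite_measure_integrable_cst.
Qed.

Lemma moment0 : moment 0 = 1.
Proof.
rewrite /moment; under eq_Rintegral do rewrite expr0.
rewrite Rintegral_cst// mul1r.
exact: (congr1 fine (probability_setT P)).
Qed.

Context (a b : R) (a1 : -1 < a) (b1 : -1 < b).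
Variables (D : (R -> R) -> R -> R) (hD : derivative_convention D).

(** The test function is x^n on [-1, 1], continued by x^-(n + 2): this matches at
    -1 and 1, since n and n + 2 have the same parity, and vanishes at infinity. *)
Lemma moment_rec n :
  (forall g, classK D a b g -> stein_identity D a b P X g) ->
  (n%:R + (a + b + 2)) * moment n.+1 = n%:R * moment n.-1 - (a - b) * moment n.
Proof.
move=> hst.
have aeX := stein_support a1 b1 hD hst.
have cX k : continuous (fun x : R => x ^+ k) by exact: exprn_continuous.
have cd : continuous (fun x : R => n%:R * x ^+ n.-1).
  by move=> x; apply: cvgM; [exact: cvg_cst|exact: cX].
have cdo (x : R) : x != 0 ->
    {for x, continuous (fun x : R => - (n.+2%:R * x^-1 ^+ n.+3))}.
  move=> x0; apply: cvgN; apply: cvgM; first exact: cvg_cst.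
  have [+ _] := is_derive_invexpr n.+3 x0 => /derivable1_diffP.
  exact: differentiable_continuous.
have e1 : (1 : R) ^+ n = 1^-1 ^+ n.+2 by rewrite invr1 !expr1n.
have eN1 : (-1 : R) ^+ n = (-1)^-1 ^+ n.+2.
  by rewrite invrN1 -addn2 exprD sqrrN expr1n mulr1.
have [] := glue_stein (is_derive_expr n) cd (@is_derive_invexpr n.+2) cdo
  e1 eN1 (@cvgy_invexpr n.+1) (@cvgNy_invexpr n.+1) a1 b1 hD hst.
set L := glue_stein_op _ _ _ _ _ _ => iL L0.
pose l (u : R) : R :=
  n%:R * u ^+ n.-1 - (n%:R + (a + b + 2)) * u ^+ n.+1 - (a - b) * u ^+ n.
have LE x : `|x| <= 1 -> L x = l x.
  move=> x1; rewrite /L /glue_stein_op glue_in// /dglue x1 /l.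
  by case: (n) => [|k] /=; rewrite !exprS; ring.
have il : P.-integrable [set: T] (fun w => (l (clamp (X w)))%:E).
  apply: integrable_clampX => x; apply: cvgB; last first.
    by apply: cvgM; [exact: cvg_cst|exact: cX].
  by apply: cvgB; apply: cvgM; (try exact: cvg_cst); exact: cX.
have : (\int[P]_w (l (clamp (X w))) = 0)%R.
  rewrite /Rintegral.
  rewrite -(_ : \int[P]_w (L (X w))%:E = \int[P]_w (l (clamp (X w)))%:E)%E.
    by rewrite L0.
  apply: ae_eq_integral => //; [exact: measurable_int iL|exact: measurable_int il|].
  apply: filterS aeX => w Xw _.
  by rewrite LE// clamp_id.
have iX k : P.-integrable [set: T] (EFin \o (fun w => clamp (X w) ^+ k)).
  exact: integrable_clampX (cX k).
have iZ c k : P.-integrable [set: T] (EFin \o (fun w => c * clamp (X w) ^+ k)).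
  rewrite /comp; under eq_fun do rewrite EFinM.
  by apply: integrableZl => //; exact: iX.
rewrite /l RintegralB//; last first.
  by rewrite /comp; under eq_fun do rewrite EFinB; apply: integrableB => //; exact: iZ.
rewrite RintegralB ?RintegralZl//; [|exact: iZ..].
rewrite -!/(moment _).
by move=> h; apply/eqP; rewrite -subr_eq0 -oppr_eq0 -[X in _ == X]h; apply/eqP; ring.
Qed.

End moments.

(** In the recursion of order two the leading coefficient n + (a + b + 2) is
    positive; for n = 0 the moment n - 1 has coefficient 0, so the recursion starts
    from the total mass. *)
Lemma moment_unique {R : realType} (a b : R) (a1 : -1 < a) (b1 : -1 < b)
  (D : (R -> R) -> R -> R) (hD : derivative_convention D)
  d (T : measurableType d) (P : probability T R) (X : {RV P >-> measurableTypeR R})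
  d' (T' : measurableType d') (P' : probability T' R)
  (X' : {RV P' >-> measurableTypeR R}) :
  (forall g, classK D a b g -> stein_identity D a b P X g) ->
  (forall g, classK D a b g -> stein_identity D a b P' X' g) ->
  moment X =1 moment X'.
Proof.
move=> h h'.
suff H : forall n, moment X n = moment X' n /\ moment X n.+1 = moment X' n.+1.
  by move=> k; have [] := H k.
have step n : moment X n.-1 = moment X' n.-1 -> moment X n = moment X' n ->
    moment X n.+1 = moment X' n.+1.
  move=> e1 e2.
  have n0 : n%:R + (a + b + 2) != 0.
    rewrite gt_eqF// ltr_wpDl//; lra.
  apply: (mulfI n0).
  by rewrite (moment_rec a1 b1 hD n h) (moment_rec a1 b1 hD n h') e1 e2.
elim=> [|n [IH1 IH2]]; last by split => //; exact: step.
have e0 : moment X 0 = moment X' 0 by rewrite !moment0.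
by split => //; exact: step.
Qed.

(** * Bernstein approximation *)

Section bernstein.
Context {R : realType}.
Implicit Types (h : nat -> R) (t : R).

(** The mean of h(N) when N is binomial with parameters n and t, conditioning on
    one trial: a form of the Bernstein polynomials without binomial
    coefficients. *)
Fixpoint bernstein (n : nat) h t : R :=
  if n is m.+1 then t * bernstein m (fun k => h k.+1) t + (1 - t) * bernstein m h t
  else h 0.

Lemma bernstein_poly n h :
  exists p : {poly R}, forall x, bernstein n h ((1 + x) / 2) = p.[x].
Proof.
elim: n h => [|n IH] h; first by exists (h 0)%:P => x; rewrite hornerC.
have [p pE] := IH (fun k => h k.+1); have [q qE] := IH h.
exists ((2^-1)%:P * (1 + 'X) * p + (2^-1)%:P * (1 - 'X) * q) => x /=.
by rewrite pE qE !hornerE; field.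
Qed.

Lemma bernstein_le n h h' t : 0 <= t <= 1 -> (forall k, h k <= h' k) ->
  bernstein n h t <= bernstein n h' t.
Proof.
move=> t01; elim: n h h' => [|n IH] h h' hh' //=.
by apply: lerD; apply: ler_wpM2l; rewrite ?subr_ge0 ?IH//; lra.
Qed.

(** The mean of (N - s)^2 is the variance n t (1 - t) plus the squared distance
    from s to the mean n t. *)
Lemma bernstein_quadratic n t c A s :
  bernstein n (fun k => c + A * (k%:R - s) ^+ 2) t =
  c + A * (n%:R * t * (1 - t) + (n%:R * t - s) ^+ 2).
Proof.
elim: n s => [|n IH] s /=; first by ring.
rewrite IH (_ : (fun k => _) = (fun k => c + A * (k%:R - (s - 1)) ^+ 2)).
  by rewrite IH -natr1; ring.
by apply/funext => k; rewrite -natr1; congr (_ + _ * _ ^+ 2); ring.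
Qed.

(** For t = (1 + x) / 2, the variable 2 N / n - 1 has mean x, and |f(2 N / n - 1)
    - f(x)| is at most 2 K |N - n t| / n.  To stay with quadratic functions of N,
    use 2 |y| <= y^2 / m + m with m = sqrt n, the order of the standard deviation:
    the mean of the error is then at most 2 K / m. *)
Lemma lipschitz_poly_approx (f : R -> R) (K e : R) :
  (forall x y, `|f x - f y| <= K * `|x - y|) -> 0 < e ->
  exists p : {poly R}, forall x, `|x| <= 1 -> `|f x - p.[x]| <= e.
Proof.
move=> fK e0.
have K0 : 0 <= K.
  by have := fK 1 0; rewrite subr0 normr1 mulr1; apply: le_trans.
pose m := (Num.truncn (2 * K / e)).+1.
have m0 : (0 : R) < m%:R by rewrite ltr0n.
have Km : 2 * K / m%:R <= e.
  have mK : 2 * K / e < m%:R by exact: truncnS_gt.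
  by rewrite ler_pdivrMr// [leRHS]mulrC -ler_pdivrMr// ltW.
pose n := (m * m)%N.
have nE : n%:R = m%:R * m%:R :> R by rewrite natrM.
have n0 : (0 : R) < n%:R by rewrite nE mulr_gt0.
pose h k := f (2 * k%:R / n%:R - 1).
have [p pE] := bernstein_poly n h.
exists p => x; rewrite ler_norml => x1; rewrite -pE.
set t := (1 + x) / 2.
have t01 : 0 <= t <= 1 by rewrite /t; lra.
have xE : x = 2 * t - 1 by rewrite /t; field.
pose q (k : nat) : R := K * (((k%:R - n%:R * t) ^+ 2 / m%:R + m%:R) / n%:R).
have hq k : `|h k - f x| <= q k.
  apply: le_trans (fK _ _) _; rewrite /q ler_wpM2l// xE.
  rewrite (_ : _ - _ = 2 * (k%:R - n%:R * t) / n%:R); last by field; rewrite gt_eqF.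
  rewrite normrM normfV (ger0_norm (ltW n0)) ler_wpM2r ?invr_ge0 ?(ltW n0)//.
  rewrite normrM ger0_norm// -real_normK ?num_real//.
  set y := `|_|.
  rewrite -subr_ge0.
  rewrite (_ : _ - _ = (y - m%:R) ^+ 2 / m%:R); last by field; rewrite gt_eqF.
  by rewrite divr_ge0 ?sqr_ge0// ltW.
have tq : t * (1 - t) <= 1 by nra.
have bq : K * ((n%:R * t * (1 - t) / m%:R + m%:R) / n%:R) <= e.
  apply: le_trans Km.
  rewrite (_ : _ * _ = K / m%:R * (t * (1 - t) + 1)); last first.
    by rewrite nE; field; rewrite gt_eqF.
  rewrite (_ : 2 * K / m%:R = K / m%:R * 2); last by ring.
  rewrite ler_wpM2l ?divr_ge0 ?(ltW m0)//; lra.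
have E c (s : R) : bernstein n (fun k => c + s * q k) t =
    c + s * (K * ((n%:R * t * (1 - t) / m%:R + m%:R) / n%:R)).
  have -> : (fun k => c + s * q k) = (fun k => (c + s * (K * (m%:R / n%:R))) +
      (s * K / m%:R / n%:R) * (k%:R - n%:R * t) ^+ 2).
    by apply/funext => k; rewrite /q; ring.
  by rewrite bernstein_quadratic; ring.
rewrite distrC ler_norml; apply/andP; split.
  rewrite lerBrDr; apply: (@le_trans _ _ (bernstein n (fun k => f x + (-1) * q k) t)).
    by rewrite E; lra.
  apply: bernstein_le => // k; have := hq k; rewrite ler_norml; lra.
rewrite lerBlDr; apply: (@le_trans _ _ (bernstein n (fun k => f x + 1 * q k) t)).
  apply: bernstein_le => // k; have := hq k; rewrite ler_norml; lra.
by rewrite E; lra.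
Qed.

End bernstein.

(** * Laws on [-1, 1] are determined by their moments *)

Section determinacy.
Context {R : realType}.
Context d (T : measurableType d) (P : probability T R)
  (X : {RV P >-> measurableTypeR R}).
Context d' (T' : measurableType d') (P' : probability T' R)
  (X' : {RV P' >-> measurableTypeR R}).
Hypothesis mXX' : moment X =1 moment X'.

Lemma Rintegral_horner d0 (T0 : measurableType d0) (P0 : probability T0 R)
    (X0 : {RV P0 >-> measurableTypeR R}) (p : {poly R}) :
  (\int[P0]_w p.[clamp (X0 w)] = \sum_(i < size p) p`_i * moment X0 i)%R.
Proof.
have iX k : P0.-integrable [set: T0] (fun w => (clamp (X0 w) ^+ k)%:E).
  exact: (integrable_clampX X0 (@exprn_continuous R k)).
suff : (\int[P0]_w (p.[clamp (X0 w)])%:E =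
    (\sum_(i < size p) p`_i * moment X0 i)%R%:E)%E.
  by rewrite /Rintegral => ->.
under eq_integral do rewrite horner_coef -sumEFin.
rewrite integral_sum//; last first.
  move=> i; under eq_fun do rewrite EFinM; exact: integrableZl.
rewrite -sumEFin; apply: eq_bigr => i _.
under eq_integral do rewrite EFinM.
rewrite integralZl// EFinM; congr (_ * _)%E.
by rewrite /moment /Rintegral fineK//; exact: integrable_fin_num.
Qed.

Lemma Rintegral_poly_eq (p : {poly R}) :
  (\int[P]_w p.[clamp (X w)] = \int[P']_w p.[clamp (X' w)])%R.
Proof. by rewrite !Rintegral_horner; apply: eq_bigr => i _; rewrite mXX'. Qed.

Lemma Rintegral_approx d0 (T0 : measurableType d0) (P0 : probability T0 R)
    (X0 : {RV P0 >-> measurableTypeR R}) (f g : R -> R) (e : R) :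
  continuous f -> continuous g ->
  (forall x, `|x| <= 1 -> `|f x - g x| <= e) ->
  `| (\int[P0]_w f (clamp (X0 w)))%R - (\int[P0]_w g (clamp (X0 w)))%R | <= e.
Proof.
move=> cf cg fg.
have i_f := integrable_clampX X0 cf.
have i_g := integrable_clampX X0 cg.
have ifg : P0.-integrable [set: T0]
    (EFin \o (fun w => f (clamp (X0 w)) - g (clamp (X0 w)))).
  by rewrite /comp; under eq_fun do rewrite EFinB; exact: integrableB.
rewrite -RintegralB//.
apply: le_trans (le_normr_Rintegral measurableT ifg) _.
rewrite [leRHS](_ : e = (\int[P0]_w (cst e w))%R); last first.
  by rewrite Rintegral_cst// (congr1 fine (probability_setT P0)) mulr1.
apply: le_Rintegral => //.
- exact: (integrable_norm ifg).
- exact: finite_measure_integrable_cst.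
- by move=> w _; apply: fg; exact: norm_clamp_le1.
Qed.

Lemma Rintegral_lipschitz_eq (f : R -> R) (K : R) :
  (forall x y, `|f x - f y| <= K * `|x - y|) -> continuous f ->
  (\int[P]_w f (clamp (X w)) = \int[P']_w f (clamp (X' w)))%R.
Proof.
move=> fK cf; apply/eqP; rewrite -subr_eq0 -normr_le0.
apply/ler_addgt0Pr => e e0; rewrite add0r.
have [p pf] := lipschitz_poly_approx fK (divr_gt0 e0 (ltr0Sn R 1)).
have cp : continuous (horner p) by exact: continuous_horner.
have h := Rintegral_approx X cf cp pf.
have h' := Rintegral_approx X' cf cp pf.
move: h h'; rewrite Rintegral_poly_eq.
set A := (\int[P]_w _)%R; set B := (\int[P']_w f _)%R; set C := (\int[P']_w _)%R.
move=> h h'; rewrite (_ : A - B = (A - C) - (B - C)); last by ring.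
by apply: le_trans (ler_normB _ _) _; rewrite [leRHS]splitr lerD.
Qed.

Hypothesis X1 : {ae P, forall w, `|X w| <= 1}.
Hypothesis X'1 : {ae P', forall w, `|X' w| <= 1}.

(** As k grows these Lipschitz functions increase to the indicator of
    ]t, +oo[. *)
Let ramp (t : R) (k : nat) (x : R) : R :=
  Num.max 0 (Num.min 1 (k%:R * (x - t))).

Lemma ramp_lipschitz t k x y : `|ramp t k x - ramp t k y| <= k%:R * `|x - y|.
Proof.
rewrite -[k%:R]ger0_norm// -normrM.
rewrite (_ : _ * _ = k%:R * (x - t) - k%:R * (y - t)); last by ring.
rewrite /ramp; set u := _ * (x - t); set v := _ * (y - t).
have cP (z : R) : let c := Num.max 0 (Num.min 1 z) in
    [\/ z <= 0 /\ c = 0, 0 <= z <= 1 /\ c = z | 1 <= z /\ c = 1].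
  move=> c; rewrite {}/c; have [z0|z0] := leP z 0.
    by constructor 1; rewrite min_r ?max_l//; lra.
  have [z1|z1] := leP z 1; [constructor 2|constructor 3].
    by rewrite max_r ?ltW//; split => //; rewrite ltW.
  by rewrite ?max_r//; lra.
have h1 := ler_norm (u - v).
have := ler_norm (v - u); rewrite distrC => h2.
rewrite ler_norml.
by case: (cP u) => -[hu ->]; case: (cP v) => -[hv ->]; lra.
Qed.

Lemma continuous_ramp t k : continuous (ramp t k).
Proof.
move=> x.
suff h : {for x, continuous (fun y : R => Num.max 0 (Num.min 1 (k%:R * (y - t))))}.
  exact: h.
have cc (c y : R) : {for y, continuous (fun _ : R => c)} by exact: cvg_cst.
apply: continuous_max => //; apply: continuous_min => //.
apply: cvgM; first exact: cvg_cst.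
by apply: cvgB; [exact: cvg_id|exact: cvg_cst].
Qed.

Lemma cvg_ramp d0 (T0 : measurableType d0) (P0 : probability T0 R)
    (X0 : {RV P0 >-> measurableTypeR R}) (t : R) :
  {ae P0, forall w, `|X0 w| <= 1} ->
  (\int[P0]_w (ramp t k (clamp (X0 w)))%:E)%E @[k --> \oo] -->
    distribution P0 X0 `]t, +oo[%classic.
Proof.
move=> aeX.
have mX : measurable_fun [set: T0] X0 by [].
have mray : measurable (`]t, +oo[%classic : set (measurableTypeR R)).
  exact: measurable_itv.
have mind0 : measurable_fun [set: T0]
    (fun w => \1_(`]t, +oo[%classic) (clamp (X0 w)) : R).
  apply: (@measurableT_comp _ _ _ _ _ _
    (\1_(`]t, +oo[%classic) : R -> R)); last exact: measurable_clampX.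
  exact: measurable_indic.
have mind := (measurable_EFinP _ _).2 mind0.
have -> : distribution P0 X0 `]t, +oo[ =
    (\int[P0]_w (\1_(`]t, +oo[) (clamp (X0 w)))%:E)%E.
  transitivity (\int[P0]_w (\1_(X0 @^-1` `]t, +oo[) w)%:E)%E.
    rewrite integral_indic//; last by rewrite -[X in measurable X]setTI; exact: mX.
    by rewrite setIT.
  apply: ae_eq_integral => //.
  - apply/measurable_EFinP; apply: measurable_indic.
    by rewrite -[X in measurable X]setTI; exact: mX.
  - by apply: filterS aeX => w Xw _; rewrite clamp_id.
have [] := @dominated_convergence _ T0 R P0 setT measurableT
  (fun k w => (ramp t k (clamp (X0 w)))%:E)
  (fun w => (\1_(`]t, +oo[%classic) (clamp (X0 w)))%:E) (cst 1%E).
- move=> k.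
  exact: measurable_int (integrable_clampX X0 (@continuous_ramp t k)).
- exact: mind.
- apply: aeW => w _; set c := clamp (X0 w).
  have [ct|tc] := leP c t.
    rewrite indicE memNset/=; last by rewrite in_itv/= andbT ltNge ct.
    rewrite (_ : (fun k => _) = cst 0%:E); first exact: cvg_cst.
    apply/funext => k; rewrite /ramp max_l// ge_min; apply/orP; right.
    by rewrite mulr_ge0_le0// subr_le0.
  rewrite indicE mem_set/=; last by rewrite in_itv/= andbT.
  apply: cvg_near_cst; near=> k; rewrite /ramp.
  have kc : 1 <= k%:R * (c - t).
    rewrite -ler_pdivrMr ?subr_gt0// mul1r.
    by near: k; exact: nbhs_infty_ger.
  by rewrite min_l// max_r.
- exact: finite_measure_integrable_cst.
- apply: aeW => w k _; rewrite abse_EFin lee_fin /ramp ger0_norm.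
    by rewrite ge_max ge_min lexx ler01.
  by rewrite le_max lexx.
- by move=> _ _ h; exact: h.
Unshelve. all: end_near. Qed.

(** Equal moments give equal means to polynomials, hence to Lipschitz functions by
    approximation on [-1, 1], hence to the ramps and in the limit to the rays
    ]t, +oo[, which generate the Borel sets and are stable under intersection. *)
Lemma distribution_unique (A : set (measurableTypeR R)) : measurable A ->
  distribution P X A = distribution P' X' A.
Proof.
apply: (@measure_unique _ R (measurableTypeR R) (@RGenOInfty.G R)
  (fun n => `](- n%:R)%R, +oo[%classic)).
- exact: RGenOInfty.measurableE.
- move=> _ _ [x ->] [y ->]; exists (Num.max x y).
  apply/seteqP; split => z /=; rewrite !in_itv/= !andbT gt_max.
    by case=> -> ->.
  by move/andP.
- by move=> n; exists (- n%:R).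
- apply/seteqP; split => // x _; exists (Num.truncn (- x)).+1 => //=.
  by rewrite in_itv/= andbT ltrNl truncnS_gt.
- move=> _ [t ->].
  have h := @cvg_ramp _ _ _ X t X1.
  have h' := @cvg_ramp _ _ _ X' t X'1.
  apply: (cvg_unique _ h) => //.
  apply: cvg_trans h'; apply: near_eq_cvg; near=> k.
  have := Rintegral_lipschitz_eq (@ramp_lipschitz t k) (@continuous_ramp t k).
  rewrite /Rintegral => e; have := congr1 EFin e.
  by rewrite !fineK//; apply: integrable_fin_num => //; apply: integrable_clampX;
    exact: continuous_ramp.
- by move=> n; apply: le_lt_trans (probability_le1 _ _) (ltry 1).
Unshelve. all: end_near. Qed.

End determinacy.

(** * The characterization *)

Theorem proposition3p1 (R : realType) (alpha beta : R)
    (halpha : -1 < alpha) (hbeta : -1 < beta)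
    (D : (R -> R) -> R -> R) (hD : derivative_convention D)
    (d : measure_display) (T : measurableType d) (P : probability T R)
    (X : {RV P >-> R}) :
  (forall A : set R, measurable A ->
     distribution P X A = beta_distr alpha beta A)
  <->
  (forall g : R -> R, classK D alpha beta g ->
     let Y := fun w : T => (1 - X w ^+ 2) * D g (X w) in
     let Z := fun w : T =>
       (alpha + beta + 2) * X w * g (X w) + (alpha - beta) * g (X w) in
     [/\ P.-integrable [set: T] (EFin \o Y),
         P.-integrable [set: T] (EFin \o Z)
       & ('E_P[Y] = 'E_P[Z])%E]).
Proof.
have [X' X'E] := RV_measurableTypeR X.
have distE A : distribution P X A = distribution P X' A.
  by rewrite /distribution /pushforward X'E.
split=> [hX g gK|hst A mA].
  have hX' A : measurable A -> distribution P X' A = beta_distr alpha beta A.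
    by move=> mA; rewrite -distE; exact: hX.
  have := beta_stein_identity halpha hbeta hD gK hX'.
  by rewrite X'E.
have hst' g : classK D alpha beta g -> stein_identity D alpha beta P X' g.
  by rewrite X'E; exact: hst.
pose Q : probability (measurableTypeR R) R := beta_measure halpha hbeta.
pose I : {mfun measurableTypeR R >-> measurableTypeR R} :=
  HB.pack (@id (measurableTypeR R))
    (isMeasurableFun.Build _ _ _ _ _ (@measurable_id _ (measurableTypeR R) setT)).
have hQ g : classK D alpha beta g ->
    stein_identity D alpha beta Q (I : {RV Q >-> measurableTypeR R}) g.
  by move=> gK; exact: beta_stein_identity.
have mE := moment_unique halpha hbeta hD hst' hQ.
have X'1 := stein_support halpha hbeta hD hst'.
have I1 := stein_support halpha hbeta hD hQ.
rewrite distE; exact: (distribution_unique mE X'1 I1 mA).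
Qed.
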